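(* Let $\mathcal{V}$ be a variety. Put $L_1=L_2=\{1,5,6\}$, $L'_1=L'_2=\{2,3,4\}$, $R_1=\{2,4,6\}$, $R'_1=\{1,3,5\}$, $R_2=\{3,4,5\}$, $R'_2=\{1,2,6\}$. Then the following are equivalent: (1) $\mathcal{V}$ is Taylor; (2) the variety $\mathcal{V}'$ generated by the abelian algebras of the idempotent reduct of $\mathcal{V}$ is Taylor; (3) there is a $6$-ary term $t$ of $\mathcal{V}$ such that $\mathcal{V}$ satisfies the commutator equations $$t(x,y,y,y,x,x) \approx_{C} t(y,x,y,x,y,x) \approx_{C} t(y,y,x,x,x,y), \qquad t(x,x,x,x,x,x)\approx_{C} x;$$ (4) $\mathcal{V}$ satisfies the following congruence equation in the variables $\alpha_1,\dots,\alpha_6,\beta_1,\dots,\beta_6$: $$\bigwedge_{i=1}^{6}(\alpha_i\circ\beta_i)\ \leq\ \Big(\big(\bigvee_{i=1}^{6}\alpha_i\big)\wedge\bigwedge_{i=1}^{2}(\tau\vee\theta_i)\Big)\vee\Big(\big(\bigvee_{i=1}^{6}\beta_i\big)\wedge\bigwedge_{i=1}^{2}(\tau\vee\theta_i)\Big),$$ where $\tau=\bigwedge_{i=1}^{6}(\alpha_i\vee\beta_i)$ and, for $i=1,2$, $$\theta_i=\Big(\bigvee_{j\in L_i}\alpha_j\vee\bigvee_{j\in L'_i}\beta_j\Big)\wedge\Big([\tau,\tau]\circ\Big(\bigvee_{j\in R_i}\alpha_j\vee\bigvee_{j\in R'_i}\beta_j\Big)\Big);$$ (5) there exists $n\in\mathbb{N}$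 such that $\mathcal{V}$ satisfies the following congruence equation in the variables $\alpha_1,\dots,\alpha_6,\beta_1,\dots,\beta_6$: $$\bigwedge_{i=1}^{6}(\alpha_i\circ\beta_i)\ \leq\ \Big(\big(\bigvee_{i=1}^{6}\alpha_i\big)\wedge\bigwedge_{i=1}^{2}(\tau\vee\theta_i)\Big)\vee\Big(\big(\bigvee_{i=1}^{6}\beta_i\big)\wedge\bigwedge_{i=1}^{2}(\tau\vee\theta_i)\Big),$$ where $\tau=\bigwedge_{i=1}^{6}(\alpha_i\vee\beta_i)$ and, for $i=1,2$, $$\theta_i=\Big(\bigvee_{j\in L_i}\alpha_j\vee\bigvee_{j\in L'_i}\beta_j\Big)\wedge\Big(\Big(\bigwedge_{m=1}^{5}(\alpha_m\vee\beta_m)\wedge\beta_6^{n}\Big)\circ\Big(\bigvee_{j\in R_i}\alpha_j\vee\bigvee_{j\in R'_i}\beta_j\Big)\Big)$$ with $\beta_6^{n}=y^{n}\big(\bigwedge_{m=1}^{5}(\alpha_m\vee\beta_m),\ \beta_6,\ \alpha_6\big)$.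
   Context: Commutator. For an algebra $\mathbf{A}$ and $\alpha,\beta,\delta\in\operatorname{Con}(\mathbf{A})$, write $C(\alpha,\beta;\delta)$ ($\alpha$ centralizes $\beta$ modulo $\delta$) if for all $n,m$, all polynomial operations $f\in\operatorname{Pol}_{n+m}(\mathbf{A})$, all $\mathbf{a},\mathbf{b}\in A^n$ and $\mathbf{u},\mathbf{v}\in A^m$ with $\mathbf{a}\equiv_\alpha\mathbf{b}$ and $\mathbf{u}\equiv_\beta\mathbf{v}$ (componentwise): if $f(\mathbf{a},\mathbf{u})\equiv_\delta f(\mathbf{a},\mathbf{v})$ then $f(\mathbf{b},\mathbf{u})\equiv_\delta f(\mathbf{b},\mathbf{v})$. The (term condition) commutator $[\alpha,\beta]$ is the smallest $\delta\in\operatorname{Con}(\mathbf{A})$ with $C(\alpha,\beta;\delta)$. An algebra is abelian if $[1,1]=0$, where $1$ and $0$ are its largest and smallest congruences. Commutator equations. For $n$-ary terms $p,q$, an algebra $\mathbf{A}$ satisfies $p\approx_C q$ if for all $\theta\in\operatorname{Con}(\mathbf{A})$ and all $a_1,\dots,a_n\in A$ in the same $\theta$-class, $(p^{\mathbf{A}}(a_1,\dots,a_n),q^{\mathbf{A}}(a_1,\dots,a_n))\in[\theta,\theta]$. A variety satisfies it if all its algebras do. A chain $p\approx_C q\approx_C r$ means $p\approx_C q$ and $q\approx_C r$. Taylor varieties. A term $t$ is idempotent in $\mathcal{V}$ if $\mathcal{V}\models t(x,\dots,x)\approx x$. An $n$-ary Taylor term is an idempotent term $f$ satisfying, for each $i\in\{1,\dots,n\}$,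 an equation $f(x_{i1},\dots,x_{in})\approx f(y_{i1},\dots,y_{in})$ with $x_{ij},y_{ij}\in\{x,y\}$ for all $j$ and $x_{ii}\neq y_{ii}$. A variety is Taylor if it has a Taylor term of some arity (equivalently, if it satisfies a non-trivial idempotent Mal'cev condition). Idempotent reduct. The idempotent reduct of an algebra $\mathbf{A}\in\mathcal{V}$ is the algebra on $A$ whose basic operations are the interpretations in $\mathbf{A}$ of all idempotent terms of $\mathcal{V}$; the idempotent reduct of $\mathcal{V}$ is the variety generated by the idempotent reducts of the algebras of $\mathcal{V}$. Congruence equations. In a congruence equation the variables range over all congruences of an arbitrary algebra of the variety; $\leq$ is inclusion of binary relations, $\wedge$ is intersection, $\circ$ is relational composition. For reflexive relations $R,S$, $R\vee S$ is the union over $k$ of the $k$-fold alternating products $R\circ S\circ R\circ\cdots$ ($k$ factors), i.e. the transitive closure of $R\cup S$; for congruences this is the join in the congruence lattice. A variety satisfies the equation if it holds for all congruences of all its algebras. Herringbone terms. $y^{0}(x,y,z)=y$ and $y^{n+1}(x,y,z)=y\vee(x\wedge y^{n}(x,z,y))$ for $n\in\mathbb{N}$. *)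

(* Defs.v *)
From Stdlib Require Import Relation_Definitions Relation_Operators.
From mathcomp Require Import all_boot.

Set Implicit Arguments.
Unset Strict Implicit.
Unset Printing Implicit Defensive.

(* Symbols form an arbitrary type; nullary symbols are allowed. *)
Record signature := Signature { symbol :> Type; arity : symbol -> nat }.

(* Carriers may be empty: an empty algebra satisfies every identity and every
   condition on congruences used below, so it never affects a variety. *)
Record algebra (S : signature) := Algebra {
  carrier :> Type;
  interp : forall o : S, ('I_(arity o) -> carrier) -> carrier }.

Inductive term (S : signature) (X : Type) :=
| Var of X
| App (o : S) of 'I_(arity o) -> term S X.
Arguments Var {S X} _.
Arguments App {S X} o _.

Fixpoint eval (S : signature) (A : algebra S) (X : Type) (e : X -> A)
    (t : term S X) : A :=
  match t with
  | Var x => e x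
  | App o ts => interp (fun i => eval e (ts i))
  end.

Fixpoint subst (S : signature) (X Y : Type) (t : term S X)
    (e : X -> term S Y) : term S Y :=
  match t with
  | Var x => e x
  | App o ts => App o (fun i => subst (ts i) e)
  end.

Definition app6 (S : signature) (X : Type) (t : term S 'I_6)
    (a b c d e f : term S X) : term S X :=
  subst t (tnth [tuple a; b; c; d; e; f]).

Definition sat (S : signature) (A : algebra S) (X : Type) (p q : term S X) :=
  forall e : X -> A, eval e p = eval e q.

Definition class_sat (S : signature) (V : algebra S -> Prop) (X : Type)
    (p q : term S X) :=
  forall A, V A -> sat A p q.

(* Varieties are taken to be equational classes. *)
Definition is_variety (S : signature) (V : algebra S -> Prop) :=
  exists Sigma : term S nat -> term S nat -> Prop,
    forall A, V A <-> forall p q, Sigma p q -> sat A p q.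

Definition generated (S : signature) (K : algebra S -> Prop) (A : algebra S) :=
  forall W : algebra S -> Prop,
    is_variety W -> (forall B, K B -> W B) -> W A.

Lemma generated_is_variety (S : signature) (K : algebra S -> Prop) :
  is_variety (generated K).
Proof.
exists (fun p q => class_sat K p q) => A; split=> [genA p q Kpq | satA W [Sigma WE] KW].
  apply: (genA (fun B => forall p q, class_sat K p q -> sat B p q)) => //.
    by exists (fun p q => class_sat K p q).
  by move=> B KB p' q'; apply.
apply/WE => p q Spq; apply: satA => B /KW /WE; exact.
Qed.

Section Relations.
Variables (S : signature) (A : algebra S).

Record congruence (theta : relation A) : Prop := Congruence {
  congruence_equiv : equivalence A theta;
  congruence_compat : forall (o : S) (a b : 'I_(arity o) -> A),
    (forall i, theta (a i) (b i)) -> theta (interp a) (interp b) }.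

Definition polynomial (k : nat) (f : ('I_k -> A) -> A) :=
  exists p : term S ('I_k + A),
    forall a, f a = eval (fun v => match v with inl i => a i | inr c => c end) p.

Definition concat (n m : nat) (a : 'I_n -> A) (u : 'I_m -> A) (i : 'I_(n + m)) : A :=
  match split i with inl j => a j | inr k => u k end.

Definition centralizes (alpha beta delta : relation A) :=
  forall (n m : nat) (f : ('I_(n + m) -> A) -> A), polynomial f ->
  forall (a b : 'I_n -> A) (u v : 'I_m -> A),
    (forall i, alpha (a i) (b i)) -> (forall j, beta (u j) (v j)) ->
    delta (f (concat a u)) (f (concat a v)) ->
    delta (f (concat b u)) (f (concat b v)).

Definition commutator (alpha beta : relation A) : relation A := fun x y =>
  forall delta, congruence delta -> centralizes alpha beta delta -> delta x y.

Lemma commutator_congruence alpha beta : congruence (commutator alpha beta).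
Proof.
split; first split.
- by move=> x d [[r _ _] _] _; apply: r.
- move=> x y z xy yz d cd zd; case: (cd) => -[_ t _] _.
  by apply: t (xy d cd zd) (yz d cd zd).
- move=> x y xy d cd zd; case: (cd) => -[_ _ s] _; exact: s (xy d cd zd).
- by move=> o a b ab d cd zd; apply: (congruence_compat cd) => i; apply: ab.
Qed.

Lemma commutator_centralizes alpha beta :
  centralizes alpha beta (commutator alpha beta).
Proof.
move=> n m f pf a b u v ab uv H d cd zd.
exact: (zd n m f pf a b u v ab uv (H d cd zd)).
Qed.

Lemma commutator_least alpha beta delta :
  congruence delta -> centralizes alpha beta delta ->
  inclusion A (commutator alpha beta) delta.
Proof. by move=> cd zd x y; apply. Qed.

Definition abelian :=
  forall x y : A, commutator (fun _ _ => True) (fun _ _ => True) x y <-> x = y.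

Definition comm_sat (n : nat) (p q : term S 'I_n) :=
  forall theta, congruence theta ->
  forall a : 'I_n -> A, (forall i j, theta (a i) (a j)) ->
    commutator theta theta (eval a p) (eval a q).

End Relations.

Definition class_comm_sat (S : signature) (V : algebra S -> Prop) (n : nat)
    (p q : term S 'I_n) :=
  forall A, V A -> comm_sat A p q.

Definition idempotent (S : signature) (V : algebra S -> Prop) (n : nat)
    (t : term S 'I_n) :=
  class_sat V (subst t (fun _ => Var ord0)) (Var ord0 : term S 'I_1).

Definition taylor_term (S : signature) (V : algebra S -> Prop) (n : nat)
    (f : term S 'I_n) :=
  idempotent V f /\
  forall i : 'I_n, exists x y : 'I_n -> 'I_2,
    x i <> y i /\
    class_sat V (subst f (fun j => Var (x j))) (subst f (fun j => Var (y j))).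

Definition taylor (S : signature) (V : algebra S -> Prop) :=
  exists (n : nat) (f : term S 'I_n), taylor_term V f.

Record idempotent_term (S : signature) (V : algebra S -> Prop) := IdempotentTerm {
  idem_arity : nat;
  idem_term :> term S 'I_idem_arity;
  idem_termP : idempotent V idem_term }.

Definition idem_signature (S : signature) (V : algebra S -> Prop) :=
  @Signature (idempotent_term V) (@idem_arity S V).

Definition idem_reduct (S : signature) (V : algebra S -> Prop) (A : algebra S) :
    algebra (idem_signature V) :=
  @Algebra (idem_signature V) A (fun t a => eval a (idem_term t)).

Definition idem_reduct_variety (S : signature) (V : algebra S -> Prop) :
    algebra (idem_signature V) -> Prop :=
  generated (fun B => exists2 A, V A & B = idem_reduct V A).

Definition abelian_idem_variety (S : signature) (V : algebra S -> Prop) :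
    algebra (idem_signature V) -> Prop :=
  generated (fun B => idem_reduct_variety B /\ abelian B).

Section RelationalOperations.
Variable A : Type.
Implicit Types (R S : relation A) (F : nat -> relation A) (s : seq nat).

Definition meet R S : relation A := fun x y => R x y /\ S x y.
Definition comp R S : relation A := fun x y => exists2 z, R x z & S z y.
(* For reflexive R and S this is the union of the alternating products. *)
Definition join R S : relation A := clos_trans A (union A R S).
Definition bigmeet s F : relation A := fun x y => forall i, i \in s -> F i x y.
Definition bigjoin s F : relation A :=
  clos_trans A (fun x y => exists2 i, i \in s & F i x y).

Fixpoint herringbone (n : nat) (x y z : relation A) : relation A :=
  match n with
  | 0 => y
  | n'.+1 => join y (meet x (herringbone n' x z y))
  end.

End RelationalOperations.

(* Families alpha, beta are used only at the indices 1, ..., 6. *)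

Definition Lset (i : nat) := [:: 1; 5; 6].
Definition Lset' (i : nat) := [:: 2; 3; 4].
Definition Rset (i : nat) := if i == 1 then [:: 2; 4; 6] else [:: 3; 4; 5].
Definition Rset' (i : nat) := if i == 1 then [:: 1; 3; 5] else [:: 1; 2; 6].

Section CongruenceEquations.
Variables (A : Type) (alpha beta : nat -> relation A).

Definition meet_joins (k : nat) : relation A :=
  bigmeet (iota 1 k) (fun i => join (alpha i) (beta i)).

Definition tau : relation A := meet_joins 6.

(* gamma is the left factor of the composition, the only part of theta_i in
   which the two congruence equations differ *)
Definition theta (gamma : relation A) (i : nat) : relation A :=
  meet (join (bigjoin (Lset i) alpha) (bigjoin (Lset' i) beta))
       (comp gamma (join (bigjoin (Rset i) alpha) (bigjoin (Rset' i) beta))).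

Definition equation (gamma : relation A) :=
  let M := bigmeet [:: 1; 2] (fun i => join tau (theta gamma i)) in
  inclusion A
    (bigmeet (iota 1 6) (fun i => comp (alpha i) (beta i)))
    (join (meet (bigjoin (iota 1 6) alpha) M)
          (meet (bigjoin (iota 1 6) beta) M)).

Definition herringbone_factor (n : nat) : relation A :=
  meet (meet_joins 5) (herringbone n (meet_joins 5) (beta 6) (alpha 6)).

End CongruenceEquations.

Definition satisfies_commutator_equation (S : signature) (V : algebra S -> Prop) :=
  forall A : algebra S, V A -> forall alpha beta : nat -> relation A,
    (forall i, 1 <= i <= 6 -> congruence (alpha i) /\ congruence (beta i)) ->
    equation alpha beta (commutator (tau alpha beta) (tau alpha beta)).

Definition satisfies_herringbone_equation (S : signature) (V : algebra S -> Prop)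
    (n : nat) :=
  forall A : algebra S, V A -> forall alpha beta : nat -> relation A,
    (forall i, 1 <= i <= 6 -> congruence (alpha i) /\ congruence (beta i)) ->
    equation alpha beta (herringbone_factor alpha beta n).

(* Main.v *)
(* A Taylor term yields an idempotent term g together with two identities
   g(r1) = g(r2), g(s1) = g(s2) in two variables such that at each coordinate at
   least one of the two identities changes the variable and, if both do, r1 and
   s1 agree there. This comes from a loop lemma for a symmetric relation absorbed
   by a Taylor operation, applied in a free algebra; the agreement of r1 and s1 is
   then obtained by composing g with itself. Identifying the coordinates of g of
   equal type gives a 6-ary term. For (3), g is taken over the
   variety generated by the abelian algebras, and quotients of congruence classes
   by [theta, theta] belong to it; the coordinates at which an identity does not
   change the variable are adjusted by the term condition. For (4) and (5),
   evaluating g at the six intermediate elements of alpha_i o beta_i gives the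
   middle element of the right-hand side.

   Conversely, if V is not Taylor, an ultrafilter argument gives a
   minor-preserving map psi from the 8-ary idempotent terms to the coordinates.
   Under psi the congruences of the free algebra on x, z_1, ..., z_6, y that
   identify z_i with x, resp. with y, behave as on the set of generators, where
   [tau, tau] and its herringbone approximations become trivial and (3), (4) and
   (5) fail. *)
Require Import Defs.
From Stdlib Require Import Relation_Definitions Relation_Operators.
From mathcomp Require Import all_boot.
From mathcomp Require Import zify.
From mathcomp Require Import boolp classical_sets filter.

Set Implicit Arguments.
Unset Strict Implicit.
Unset Printing Implicit Defensive.

(** * Loops in absorbed symmetric relations *)

Section Absorption.
Variables (A : Type) (n : nat) (f : ('I_n -> A) -> A).
Hypothesis f_idem : forall a, f (fun _ => a) = a.
Implicit Types E : A -> A -> Prop.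

Definition sym_rel E := forall a b, E a b -> E b a.

(** In the language of absorption, [E] absorbs the full binary relation through [f]: one coordinate
    may be left unconstrained. *)
Definition absorbing E := forall (l : 'I_n) (a b : 'I_n -> A),
  (forall i, i != l -> E (a i) (b i)) -> E (f a) (f b).

Definition clique E m (q : 'I_m -> A) := forall i j, i != j -> E (q i) (q j).

(* [w] is a walk of length [L] from [a] to [b] inside the common neighbourhood
   of the [p]-clique [h]. *)
Definition hub_walk E p L a b :=
  exists (h : 'I_p -> A) (w : nat -> A), [/\ w 0 = a, w L = b,
    forall t, t < L -> E (w t) (w t.+1),
    forall k t, t <= L -> E (h k) (w t) & clique E h].

Lemma absorbing_compat E (a b : 'I_n -> A) :
  absorbing E -> 0 < n -> (forall i, E (a i) (b i)) -> E (f a) (f b).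
Proof. by move=> absE n_gt0 Eab; apply: (absE (Ordinal n_gt0)). Qed.

Lemma arity0_eq (a b : A) : n = 0 -> a = b.
Proof.
move=> n0; rewrite -(f_idem a) -(f_idem b); congr f.
by apply: funext => -[i lti]; exfalso; rewrite n0 in lti.
Qed.

(** As [q i] is [f] of a constant tuple, absorption at [i] makes [q i] adjacent to [f q]. Applying
    [f] to these [n] edges gives a loop at [f q]. *)
Lemma clique_loop E (q : 'I_n -> A) :
  0 < n -> absorbing E -> clique E q -> exists a, E a a.
Proof.
move=> n_gt0 absE cq; exists (f q); rewrite -{2}(f_idem (f q)).
apply: absorbing_compat => // i; rewrite -{1}(f_idem (q i)).
by apply: (absE i) => j ji; apply: cq; rewrite eq_sym.
Qed.

Lemma clique_comp E m p (q : 'I_m -> A) (s : 'I_p -> 'I_m) :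
  injective s -> clique E q -> clique E (q \o s).
Proof. by move=> sI cq i j ij /=; apply: cq; rewrite (inj_eq sI). Qed.

Definition fcons m a (q : 'I_m -> A) : 'I_m.+1 -> A :=
  fun i => if unlift ord0 i is Some k then q k else a.

Lemma fcons0 m a (q : 'I_m -> A) : fcons a q ord0 = a.
Proof. by rewrite /fcons unlift_none. Qed.

Lemma fconsS m a (q : 'I_m -> A) k : fcons a q (lift ord0 k) = q k.
Proof. by rewrite /fcons liftK. Qed.

Lemma clique_fcons E m a (q : 'I_m -> A) :
  sym_rel E -> (forall k, E a (q k)) -> clique E q -> clique E (fcons a q).
Proof.
move=> symE Ea cq i j; case: (unliftP ord0 i) => [i'|] ->;
  case: (unliftP ord0 j) => [j'|] ->; rewrite ?fcons0 ?fconsS ?eqxx // => ij.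
- by apply: cq; apply: contra_neq ij => ->.
- exact/symE.
Qed.

Lemma hub_walk_sym E p L : sym_rel E -> sym_rel (hub_walk E p L).
Proof.
move=> symE a b [h [w [w0 wL Ew Eh ch]]]; exists h, (fun t => w (L - t)).
split=> // [|||k t _]; rewrite ?subn0 ?subnn //; last by apply: Eh; lia.
move=> t tL; have -> : L - t = (L - t.+1).+1 by lia.
by apply/symE/Ew; lia.
Qed.

Lemma hub_walk_absorbing E p L :
  0 < L -> absorbing E -> absorbing (hub_walk E p L).
Proof.
move=> L_gt0 absE l a b Eab.
have /fin_all_exists[h /fin_all_exists[w hw]] : forall i, exists h w,
    [/\ w 0 = a i, w L = b i & i != l ->
      [/\ forall t, t < L -> E (w t) (w t.+1),
        forall k t, t <= L -> E (h k) (w t) & @clique E p h]].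
  move=> i; case: (eqVneq i l) => [_ | il]; last first.
    by have [h [w []]] := Eab i il; exists h, w; split.
  (* At the free coordinate only the endpoints matter; they can be prescribed independently because
     [L] is positive. *)
  by exists (fun=> a i), (fun t => if t is 0 then a i else b i); case: (L) L_gt0.
exists (fun k => f (h^~ k)), (fun t => f (w^~ t)); split.
- by congr f; apply: funext => i; case: (hw i).
- by congr f; apply: funext => i; case: (hw i).
- by move=> t tL; apply: (absE l) => i il; case: (hw i) => _ _ /(_ il) [+ _ _]; exact.
- by move=> k t tL; apply: (absE l) => i il; case: (hw i) => _ _ /(_ il) [_ + _]; exact.
- by move=> k k' kk; apply: (absE l) => i il; case: (hw i) => _ _ /(_ il) [_ _ +]; exact.
Qed.

(** The walk oscillates between [q i] and [q j] and ends at [q j] because [L] is odd; the remaining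
    [p] vertices form the hub. *)
Lemma clique_hub_walk E p L (q : 'I_p.+2 -> A) i j :
  sym_rel E -> odd L -> clique E q -> i != j -> hub_walk E p L (q i) (q j).
Proof.
move=> symE oddL cq ij; have [j' jE] : exists j', j = lift i j'.
  by case: (unliftP i j) ij => [j' ->|->]; [exists j' | rewrite eqxx].
exists (fun k => q (lift i (lift j' k))), (fun t => if odd t then q j else q i).
split; rewrite ?oddL //=.
- by move=> t _; case: (odd t) => /=; apply: cq; rewrite // eq_sym.
- move=> k t _; case: (odd t); apply: cq; rewrite eq_sym ?neq_lift //.
  by rewrite jE (inj_eq (@lift_inj _ i)) neq_lift.
- by move=> k k' kk; apply: cq; rewrite !(inj_eq (@lift_inj _ _)).
Qed.

(* All coordinates of [f] alternate between two adjacent vertices, except that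
   coordinate [t] is released at step [t], which allows any parity. *)
Lemma closed_hub_walk E p (q : 'I_p.+2 -> A) :
  0 < n -> sym_rel E -> absorbing E -> clique E q ->
  exists2 L, odd L & exists a, hub_walk E p L a a.
Proof.
move=> n_gt0 symE absE cq.
have [L oddL nL] : exists2 L, odd L & n <= L.
  by exists n.*2.+1; rewrite /= ?odd_double //; lia.
pose c (b : bool) := if b then q ord0 else q (lift ord0 ord0).
have Ec b : E (c b) (c (~~ b)) by case: b; apply: cq.
pose h k := q (lift ord0 (lift ord0 k)).
have Eh k b : E (h k) (c b).
  by case: b; apply: cq; rewrite ?(inj_eq (@lift_inj _ _)) // eq_sym neq_lift.
pose w t := f (fun i : 'I_n => c (if t <= i then odd t else odd (L - t))).
exists L => //; exists (c false), h, w; split.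
- by rewrite /w -[RHS]f_idem.
- rewrite /w -[RHS]f_idem subnn; congr f; apply: funext => i.
  by rewrite leqNgt (leq_trans (ltn_ord i) nL).
- move=> t tL; case: (ltnP t n) => tn; last first.
    apply: absorbing_compat => // i; have itn := leq_trans (ltn_ord i) tn.
    have -> : L - t = (L - t.+1).+1 by lia.
    by rewrite ltnNge (leqNgt t) itn (ltnW itn) /=; apply/symE.
  apply: (absE (Ordinal tn)) => i; rewrite -val_eqE /= => it.
  case: (ltnP t i) => ti; first by rewrite (ltnW ti); apply: Ec.
  rewrite leqNgt ltn_neqAle it ti /=.
  have -> : L - t = (L - t.+1).+1 by lia.
  exact/symE/Ec.
- move=> k t _; rewrite -(f_idem (h k)).
  by apply: absorbing_compat.
- by move=> k k' kk; apply: cq; rewrite !(inj_eq (@lift_inj _ _)).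
Qed.

(** Two nested inductions. The outer one enlarges the clique up to [n] vertices at the price of
    replacing [E] by a hub-walk relation, hence the generalization over [E]. The inner one shortens
    a closed odd hub walk by two until it is a loop. *)
Lemma clique_loop_gen p E (q : 'I_p.+2 -> A) :
  0 < n -> sym_rel E -> absorbing E -> clique E q -> exists a, E a a.
Proof.
move: {2}(n - p.+2) (leqnn (n - p.+2)) => d.
elim: d p E q => [|d IHd] p E q led n_gt0 symE absE cq; last first.
  have [N oddN [b Ebb]] := closed_hub_walk n_gt0 symE absE cq.
  suff shrink : forall N L a, L <= N -> odd L -> hub_walk E p L a a ->
      exists c, E c c by apply: (shrink N N b).
  elim=> [|{oddN Ebb b}N IHN] L a leL oddL Eaa; first by case: L leL oddL {Eaa}.
  case: (ltnP L 3) => [L3 | L3].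
    have L1 : L = 1 by lia.
    case: Eaa => h [w [w0 wL Ew _ _]]; exists a.
    by rewrite -{1}w0 -wL L1; apply: Ew; rewrite L1.
  have oddL2 : odd (L - 2) by lia.
  (* A loop of [Phi] is a closed hub walk of length [L - 2]. The larger clique for [Phi] consists of
     the hub and [w 0], [w 1], [w 2]. *)
  pose Phi := hub_walk E p (L - 2).
  have symPhi : sym_rel Phi by apply: hub_walk_sym.
  have absPhi : absorbing Phi by apply: hub_walk_absorbing; [lia|].
  case: Eaa => h [w [w0 wL Ew Eh ch]].
  have c1 : clique E (fcons (w 0) (fcons (w 1) h)).
    apply: clique_fcons => // [k|]; last first.
      by apply: clique_fcons => // k; apply/symE/Eh; lia.
    by case: (unliftP ord0 k) => [k'|] ->; rewrite ?fcons0 ?fconsS;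
      [apply/symE/Eh | apply: Ew; lia].
  have c2 : clique E (fcons (w 1) (fcons (w 2) h)).
    apply: clique_fcons => // [k|]; last first.
      by apply: clique_fcons => // k; apply/symE/Eh; lia.
    by case: (unliftP ord0 k) => [k'|] ->; rewrite ?fcons0 ?fconsS;
      [apply/symE/Eh; lia | apply: Ew; lia].
  have P1 i j : i != j -> Phi _ _ := clique_hub_walk symE oddL2 c1.
  have P2 i j : i != j -> Phi _ _ := clique_hub_walk symE oddL2 c2.
  (* The rest of the closed walk leads from [w 2] back to [w 0] in [L - 2] steps. *)
  have P02 : Phi (w 0) (w 2).
    apply: symPhi; exists h, (fun t => w t.+2); split=> //.
    - by rewrite w0 -wL; congr w; lia.
    - by move=> t tL; apply: Ew; lia.
    - by move=> k t tL; apply: Eh; lia.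
  have cPhi : clique Phi (fcons (w 0) (fcons (w 1) (fcons (w 2) h))).
    apply: clique_fcons => //.
      move=> k; case: (unliftP ord0 k) => [k1|] ->; rewrite ?fcons0 ?fconsS.
        case: (unliftP ord0 k1) => [k2|] ->; rewrite ?fcons0 ?fconsS //.
        by have := P1 ord0 (lift ord0 (lift ord0 k2)); rewrite fcons0 !fconsS; apply.
      by have := P1 ord0 (lift ord0 ord0); rewrite fcons0 !fconsS fcons0; apply.
  have [c Pc] : exists c, Phi c c by apply: IHd cPhi => //; lia.
  by apply: (IHN (L - 2) c) => //; lia.
have np : n <= p.+2 by lia.
apply: (clique_loop (q := q \o widen_ord np)) => //.
by apply: clique_comp => // i j /(congr1 val) /= /val_inj.
Qed.

Theorem absorbing_sym_loop E a b :
  sym_rel E -> absorbing E -> E a b -> exists c, E c c.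
Proof.
case: (posnP n) => [n0 _ _ Eab | n_gt0 symE absE Eab].
  by exists a; rewrite {2}(arity0_eq a b n0).
apply: (@clique_loop_gen 0 E (fcons a (fcons b (fun=> a)))) => //.
apply: clique_fcons => // [k|].
  by case: (unliftP ord0 k) => [[]//|] ->; rewrite fcons0.
by apply: clique_fcons => // -[].
Qed.

End Absorption.

(** * Terms, subquotients and free algebras *)

Lemma eval_subst (S : signature) (A : algebra S) (X Y : Type) (e : Y -> A)
    (t : term S X) (s : X -> term S Y) :
  eval e (subst t s) = eval (fun x => eval e (s x)) t.
Proof.
by elim: t => //= o ts IH; congr interp; apply: funext => i; apply: IH.
Qed.

Lemma subst_Var (S : signature) (X : Type) (t : term S X) : subst t Var = t.
Proof.
by elim: t => //= o ts IH; congr App; apply: funext => i; apply: IH.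
Qed.

Lemma eval_app6 (S : signature) (A : algebra S) (X : Type) (e : X -> A)
    (t : term S 'I_6) a b c d i j :
  eval e (app6 t a b c d i j) =
  eval (tnth [tuple eval e a; eval e b; eval e c; eval e d; eval e i; eval e j]) t.
Proof.
rewrite /app6 eval_subst; congr eval; apply: funext => k.
by case: k => -[|[|[|[|[|[|//]]]]]] lt; rewrite !(tnth_nth a) !(tnth_nth (eval e a)).
Qed.

Lemma eval_app6_diag (S : signature) (A : algebra S) (X : Type) (e : X -> A)
    (t : term S 'I_6) a :
  eval e (app6 t a a a a a a) = eval (fun _ => eval e a) t.
Proof.
rewrite eval_app6; congr eval; apply: funext.
by case=> -[|[|[|[|[|[|//]]]]]] lt; rewrite (tnth_nth (eval e a)).
Qed.

Section Congruences.
Variables (S : signature) (A : algebra S) (theta : relation A).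
Hypothesis ctheta : congruence theta.

Lemma con_refl a : theta a a.
Proof. by case: ctheta => -[]. Qed.

Lemma con_sym a b : theta a b -> theta b a.
Proof. by case: ctheta => -[_ _ s] _; apply: s. Qed.

Lemma con_trans b a c : theta a b -> theta b c -> theta a c.
Proof. by case: ctheta => -[_ t _] _; apply: t. Qed.

Lemma con_eval (X : Type) (e e' : X -> A) (t : term S X) :
  (forall x, theta (e x) (e' x)) -> theta (eval e t) (eval e' t).
Proof. by move=> ee; elim: t => //= o ts IH; apply: congruence_compat. Qed.

End Congruences.

(* The quotient by [D] of the subalgebra [U]; its elements are canonical
   representatives of the [D]-classes. *)
Section Subquotient.
Variables (S : signature) (A : algebra S) (D : relation A) (U : A -> Prop).
Hypothesis cD : congruence D.
Hypothesis U_closed : forall (o : S) (a : 'I_(arity o) -> A),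
  (forall i, U (a i)) -> U (interp a).
Hypothesis U_saturated : forall a b, U a -> D a b -> U b.

Definition crep a : A := sval (cid (ex_intro (D a) a (con_refl cD a))).

Lemma crepP a : D a (crep a).
Proof. by rewrite /crep; case: cid. Qed.

(** The representative is chosen from the predicate [D a]. Related elements have equal predicates,
    hence, by proof irrelevance, the same choice. *)
Lemma crep_eq a b : D a b -> crep a = crep b.
Proof.
move=> ab; have DE : D a = D b.
  apply/funext => c; apply/propext.
  by split; apply: con_trans => //; apply: con_sym.
rewrite /crep; move: (ex_intro _ a _) (ex_intro _ b _).
by case: _ / DE => P Q; rewrite (Prop_irrelevance P Q).
Qed.

Definition sq_carrier := {a : A | U a /\ crep a = a}.

Lemma sq_inj_proof a : U a -> U (crep a) /\ crep (crep a) = crep a.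
Proof.
move=> Ua; split; first exact: U_saturated (crepP a).
exact/esym/crep_eq/crepP.
Qed.

Definition sq_inj a (Ua : U a) : sq_carrier := exist _ (crep a) (sq_inj_proof Ua).

Definition subquotient : algebra S := @Algebra S sq_carrier
  (fun o a => sq_inj (U_closed (fun i => proj1 (svalP (a i))))).

Lemma sq_eqP (a b : subquotient) : a = b <-> D (sval a) (sval b).
Proof.
split=> [->|]; first exact: con_refl.
case: a b => [a Pa] [b Pb] /= /crep_eq; rewrite (proj2 Pa) (proj2 Pb) => eab.
by subst b; congr exist; apply: Prop_irrelevance.
Qed.

Lemma sq_eval (X : Type) (e : X -> subquotient) (t : term S X) :
  D (eval (sval \o e) t) (sval (eval e t)).
Proof.
elim: t => [x|o ts IH] /=; first exact: con_refl.
apply: (con_trans cD) (crepP _).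
exact: congruence_compat.
Qed.

Lemma sq_sat (X : Type) (p q : term S X) :
  (forall e : X -> A, (forall x, U (e x)) -> D (eval e p) (eval e q)) ->
  sat subquotient p q.
Proof.
move=> H e; apply/sq_eqP.
apply: (con_trans cD) (sq_eval _ _); apply: (con_trans cD) (H _ _).
  by apply: (con_sym cD); apply: sq_eval.
by move=> x /=; case: (e x) => a [].
Qed.

End Subquotient.

Section FreeAlgebra.
Variables (S : signature) (V : algebra S -> Prop) (X : Type).

Definition term_algebra : algebra S := @Algebra S (term S X) (@App S X).

Lemma eval_term_algebra (Y : Type) (e : Y -> term_algebra) (t : term S Y) :
  eval e t = subst t e.
Proof. by elim: t => //= o ts IH; congr App; apply: funext => i; apply: IH. Qed.

Lemma class_sat_congruence : congruence (@class_sat S V X : relation term_algebra).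
Proof.
split; first split.
- by [].
- by move=> p q r pq qr A VA e; rewrite (pq A) // (qr A).
- by move=> p q pq A VA e; rewrite (pq A).
- by move=> o a b ab A VA e /=; congr interp; apply: funext => i; apply: ab.
Qed.

Definition free_algebra : algebra S :=
  @subquotient S term_algebra (@class_sat S V X) (fun _ => True)
    class_sat_congruence (fun _ _ _ => I) (fun _ _ _ _ => I).

Definition free_gen (x : X) : free_algebra :=
  sq_inj class_sat_congruence (fun _ _ _ _ => I)
    (I : (fun _ => True) (Var x : term_algebra)).

Definition free_term (u : free_algebra) : term S X := sval u.

Lemma free_eqP (u v : free_algebra) :
  u = v <-> class_sat V (free_term u) (free_term v).
Proof.
exact: (@sq_eqP S term_algebra (@class_sat S V X) (fun _ => True)
  class_sat_congruence (fun _ _ _ => I) (fun _ _ _ _ => I) u v).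
Qed.

Lemma free_eval (Y : Type) (e : Y -> free_algebra) (t : term S Y) :
  class_sat V (subst t (free_term \o e)) (free_term (eval e t)).
Proof.
have := @sq_eval S term_algebra (@class_sat S V X) (fun _ => True)
  class_sat_congruence (fun _ _ _ => I) (fun _ _ _ _ => I) Y e t.
by rewrite eval_term_algebra.
Qed.

Lemma free_gen_term (x : X) : class_sat V (Var x) (free_term (free_gen x)).
Proof. exact: (crepP class_sat_congruence (Var x : term_algebra)). Qed.

Lemma class_sat_subst (Y Z : Type) (p q : term S Y) (s s' : Y -> term S Z) :
  class_sat V p q -> (forall y, class_sat V (s y) (s' y)) ->
  class_sat V (subst p s) (subst q s').
Proof.
move=> pq ss A VA e; rewrite !eval_subst (pq A VA).
by congr eval; apply: funext => y; apply: ss.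
Qed.

Lemma class_sat_trans (Y : Type) (q p r : term S Y) :
  class_sat V p q -> class_sat V q r -> class_sat V p r.
Proof. by move=> pq qr A VA e; rewrite (pq A) // (qr A). Qed.

Lemma class_sat_sym (Y : Type) (p q : term S Y) :
  class_sat V p q -> class_sat V q p.
Proof. by move=> pq A VA e; rewrite (pq A). Qed.

Lemma free_eval_gen (t : term S X) :
  class_sat V t (free_term (eval free_gen t)).
Proof.
apply: class_sat_trans (free_eval _ _); rewrite -{1}(subst_Var t).
by apply: class_sat_subst => // x; apply: free_gen_term.
Qed.

Lemma free_gen_eq (t t' : term S X) :
  eval free_gen t = eval free_gen t' <-> class_sat V t t'.
Proof.
rewrite free_eqP; split=> tt.
  apply: class_sat_trans (free_eval_gen t) _; apply: class_sat_trans tt _.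
  exact/class_sat_sym/free_eval_gen.
apply: class_sat_trans (class_sat_sym (free_eval_gen t)) _.
exact: class_sat_trans tt (free_eval_gen t').
Qed.

Lemma free_eval_term (u : free_algebra) : eval free_gen (free_term u) = u.
Proof. exact/free_eqP/class_sat_sym/free_eval_gen. Qed.

Lemma free_sat (Y : Type) (p q : term S Y) : class_sat V p q -> sat free_algebra p q.
Proof.
by move=> pq; apply: sq_sat => e _; rewrite !eval_term_algebra; apply: class_sat_subst.
Qed.

Lemma free_mem : is_variety V -> V free_algebra.
Proof.
move=> [Sigma VE]; apply/VE => p q Spq; apply: free_sat => A VA.
by move: VA => /VE /(_ _ _ Spq).
Qed.

End FreeAlgebra.

Arguments free_algebra : simpl never.

(** * Two aligned identities from a Taylor term *)

Definition letter := (bool * bool * bool * bool)%type.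

(* A letter lists the values at one coordinate of four rows; rows 1, 2 are one
   pair and rows 3, 4 another. *)
Definition double_loop_letter : pred letter :=
  fun l => let: (b1, b2, b3, b4) := l in (b1 != b2) || (b3 != b4).

Definition aligned_letter : pred letter :=
  fun l => let: (b1, b2, b3, b4) := l in
  double_loop_letter l && ((b1 != b2) && (b3 != b4) ==> (b1 == b3)).

Definition letters (G : pred letter) := {l : letter | G l}.
Definition row1 G (l : letters G) : bool := (sval l).1.1.1.
Definition row2 G (l : letters G) : bool := (sval l).1.1.2.
Definition row3 G (l : letters G) : bool := (sval l).1.2.
Definition row4 G (l : letters G) : bool := (sval l).2.

Section DoubleLoop.
Variables (T : signature) (W : algebra T -> Prop).
Hypothesis W_idem : forall A, W A ->
  forall (o : T) (a : A), interp (fun _ : 'I_(arity o) => a) = a.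
Variables (n : nat) (f : term T 'I_n).
Hypothesis f_taylor : forall l : 'I_n, exists rho sigma : 'I_n -> bool,
  rho l <> sigma l /\
  class_sat W (subst f (fun i => Var (rho i))) (subst f (fun i => Var (sigma i))).

Lemma eval_const (X : Type) (A : algebra T) (t : term T X) (a : A) :
  W A -> eval (fun _ => a) t = a.
Proof.
move=> WA; elim: t => //= o ts IH; rewrite -[RHS](W_idem WA o).
by congr interp; apply: funext.
Qed.

Notation F := (free_algebra W bool).
Notation v := (@free_gen T W bool).
Implicit Types (G : pred letter) (e : bool -> F) (u p q r s : F).

Lemma eval_constF (X : Type) (t : term T X) u : eval (fun _ => u) t = u.
Proof.
have st : class_sat W (subst t (fun _ => Var tt)) (Var tt).
  by move=> A WA e; rewrite eval_subst /= eval_const.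
by have := free_sat st (fun _ => u); rewrite eval_subst.
Qed.

Lemma eval_freeF (X : Type) (g : term T X) (r s : X -> bool) e :
  eval (fun i => v (r i)) g = eval (fun i => v (s i)) g ->
  eval (fun i => e (r i)) g = eval (fun i => e (s i)) g.
Proof.
have gE e' (r' : X -> bool) :
    eval (fun i => e' (r' i)) g = eval e' (subst g (fun i => Var (r' i))).
  by rewrite eval_subst.
by rewrite !gE => /free_gen_eq /free_sat ->.
Qed.

(** Membership in the subalgebra of the fourth power of [F] generated by the quadruples of free
    generators that [G] allows. *)
Definition gen G p q r s := exists g : term T (letters G),
  [/\ p = eval (fun i => v (row1 i)) g, q = eval (fun i => v (row2 i)) g,
      r = eval (fun i => v (row3 i)) g & s = eval (fun i => v (row4 i)) g].

Lemma gen_letter G b1 b2 b3 b4 :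
  G (b1, b2, b3, b4) -> gen G (v b1) (v b2) (v b3) (v b4).
Proof.
by move=> Gb; exists (Var (exist (fun l => G l) (b1, b2, b3, b4) Gb : letters G)).
Qed.

Lemma gen_eval G (Y : Type) (t : term T Y) (a b c d : Y -> F) :
  (forall y, gen G (a y) (b y) (c y) (d y)) ->
  gen G (eval a t) (eval b t) (eval c t) (eval d t).
Proof.
move=> H; elim: t => //= o ts IH.
have /fin_all_exists[g gP] := IH.
by exists (App o g); split; rewrite [RHS]/=; congr (interp _);
  apply: funext => i; case: (gP i).
Qed.

Lemma gen_ind G (Q : F -> F -> F -> F -> Prop) p q r s :
  (forall b1 b2 b3 b4, G (b1, b2, b3, b4) -> Q (v b1) (v b2) (v b3) (v b4)) ->
  (forall o (a b c d : 'I_(arity o) -> F),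
     (forall i, Q (a i) (b i) (c i) (d i)) ->
     Q (interp a) (interp b) (interp c) (interp d)) ->
  gen G p q r s -> Q p q r s.
Proof.
move=> Ql Qo [g [-> -> -> ->]]; elim: g => [[[[[b1 b2] b3] b4] Gb]|o ts IH] /=.
  exact: Ql.
exact: Qo.
Qed.

Lemma gen_eval34 G (Y : Type) (t : term T Y) p q (c d : Y -> F) :
  (forall y, gen G p q (c y) (d y)) -> gen G p q (eval c t) (eval d t).
Proof.
move=> H; rewrite -(eval_constF t p) -[X in gen _ _ X](eval_constF t q).
exact: gen_eval.
Qed.

Lemma gen_eval12 G (Y : Type) (t : term T Y) (a b : Y -> F) r s :
  (forall y, gen G (a y) (b y) r s) -> gen G (eval a t) (eval b t) r s.
Proof.
move=> H; rewrite -(eval_constF t r) -[X in gen _ _ _ _ X](eval_constF t s).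
exact: gen_eval.
Qed.

(** By idempotence the admissible [p] form a subalgebra once the other three entries are fixed, so
    testing the generators is enough. *)
Lemma gen_all1 G q r s : (forall b, gen G (v b) q r s) -> forall p, gen G p q r s.
Proof.
move=> H p; rewrite -(free_eval_term p) -(eval_constF (free_term p) q).
exact: gen_eval12.
Qed.

Lemma gen_all2 G p r s : (forall b, gen G p (v b) r s) -> forall q, gen G p q r s.
Proof.
move=> H q; rewrite -(free_eval_term q) -(eval_constF (free_term q) p).
exact: gen_eval12.
Qed.

Lemma gen_swap12 p q r s :
  gen double_loop_letter p q r s -> gen double_loop_letter q p r s.
Proof.
apply: (gen_ind (Q := fun p q => gen double_loop_letter q p)).
  by move=> b1 b2 b3 b4 H; apply: gen_letter; rewrite /= eq_sym.
by move=> o a b c d H; apply: (@gen_eval _ _ (App o Var)).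
Qed.

Lemma gen_swap p q r s : gen aligned_letter p q r s -> gen aligned_letter q p s r.
Proof.
apply: (gen_ind (Q := fun p q r s => gen aligned_letter q p s r)).
  by move=> b1 b2 b3 b4 H; apply: gen_letter; case: b1 b2 b3 b4 H => -[] [] [].
by move=> o a b c d H; apply: (@gen_eval _ _ (App o Var)).
Qed.

Section Helper.
Local Notation dgen := (gen double_loop_letter).

Definition split_pair e := forall p q c, dgen p q (e c) (e (~~ c)).

Definition pair_of e (t : term T bool) : bool -> F :=
  fun c => if c then eval e t else eval (e \o negb) t.

(* A single word works for all pairs [e], which makes it possible to compose the
   words of several edges and thereby to show that the relation is absorbed. *)
Definition helped p q := exists t : term T bool,
  forall e, split_pair e -> dgen p q (eval e t) (eval e t).

Lemma split_pair_negb e : split_pair e -> split_pair (e \o negb).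
Proof. by move=> Pe p q c; apply: Pe. Qed.

Lemma split_pair_of e t : split_pair e -> split_pair (pair_of e t).
Proof.
move=> Pe p q [] /=; apply: gen_eval34 => c; last by rewrite /= -{2}(negbK c).
exact: Pe.
Qed.

Lemma split_pair_gen : split_pair v.
Proof.
move=> p q c; apply: gen_all1 => b1; apply: gen_all2 => b2.
by apply: gen_letter => /=; case: c; rewrite orbT.
Qed.

Definition comp_word (t r : term T bool) :=
  subst t (fun c => if c then r else subst r (fun b => Var (~~ b))).

Lemma eval_comp_word e (t r : term T bool) :
  eval e (comp_word t r) = eval (pair_of e r) t.
Proof.
by rewrite eval_subst; congr eval; apply: funext => -[] //=; rewrite eval_subst.
Qed.

(** The composite evaluates the word [t] of the tail at the pair made of the head's word [r] and its
    swap. The head edge is helped by both entries of that pair, and the tail edges by [t], since the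
    pair is again split. *)
Lemma helped_common (a b : 'I_n -> F) (s : seq 'I_n) :
  (forall i, i \in s -> helped (a i) (b i)) ->
  exists t, forall e i, split_pair e -> i \in s ->
    dgen (a i) (b i) (eval e t) (eval e t).
Proof.
elim: s => [|j s IH] H; first by exists (Var true).
have [t tP] := IH (fun i si => H i (@mem_behead _ (j :: s) i si)).
have [r rP] := H j (mem_head j s).
exists (comp_word t r) => e i Pe; rewrite inE eval_comp_word => /predU1P[->|si].
  apply: gen_eval34 => -[]; first exact: rP.
  exact/rP/split_pair_negb.
by apply: tP => //; apply: split_pair_of.
Qed.

Lemma helped_sym : sym_rel helped.
Proof. by move=> p q [t tP]; exists t => e Pe; apply/gen_swap12/tP. Qed.

(** Where the two sides of the Taylor identity for [l] agree, the coordinate differs from [l] and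
    the common word [t] applies; where they disagree, a split pair accepts any [a i] and [b i]. *)
Lemma helped_absorbing : absorbing (fun a : 'I_n -> F => eval a f) helped.
Proof.
move=> l a b Hab; have [rho [sigma [rsl rsE]]] := f_taylor l.
have [|t tP] := @helped_common a b [seq i <- enum 'I_n | i != l].
  by move=> i; rewrite mem_filter => /andP[il _]; apply: Hab.
exists (comp_word (subst f (fun i => Var (rho i))) t) => e Pe.
rewrite eval_comp_word; have := free_sat rsE (pair_of e t).
rewrite !eval_subst /= => E; rewrite [X in gen _ _ _ _ X]E.
apply: gen_eval => i; case: (eqVneq (rho i) (sigma i)) => [rsi | rsi].
  have il : i != l by apply: contra_not_neq rsl => <-.
  have si : i \in [seq i <- enum 'I_n | i != l] by rewrite mem_filter il mem_enum.
  by rewrite -rsi; case: (rho i) => /=; apply: tP => //; apply: split_pair_negb.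
have -> : sigma i = ~~ rho i by case: (rho i) (sigma i) rsi => -[].
exact: split_pair_of.
Qed.

Lemma double_loop : exists g : term T (letters double_loop_letter),
  (forall e, eval (fun i => e (row1 i)) g = eval (fun i => e (row2 i)) g) /\
  (forall e, eval (fun i => e (row3 i)) g = eval (fun i => e (row4 i)) g).
Proof.
(* Rows 1 and 2 already differ, so rows 3 and 4 are unconstrained. *)
have edge : helped (v true) (v false).
  exists (Var true) => e _ /=; rewrite -(free_eval_term (e true)).
  by apply: gen_eval34 => b; apply: gen_letter.
have f_idem u : eval (fun _ => u) f = u by apply: eval_constF.
have [u [t tP]] := absorbing_sym_loop f_idem helped_sym helped_absorbing edge.
have [g [g1 g2 g3 g4]] := tP v split_pair_gen.
by exists g; split=> e; apply: eval_freeF; [rewrite -g1 -g2 | rewrite -g3 -g4].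
Qed.

End Helper.

Local Notation agen := (gen aligned_letter).

(* [a] and [b] below are separated whatever happens on rows 3 and 4; composing
   the double loop with the pair [a, b] then gives the alignment. *)
Lemma aligned_loop : exists g : term T (letters aligned_letter),
  class_sat W (subst g (fun i => Var (row1 i))) (subst g (fun i => Var (row2 i))) /\
  class_sat W (subst g (fun i => Var (row3 i))) (subst g (fun i => Var (row4 i))).
Proof.
have [g [gR gS]] := double_loop.
(* [s true] and [s false] are exchanged by swapping the generators, and each has two presentations,
   by row 3 and by row 4. Below, [t] repeats this over [s] with rows 1 and 2. *)
pose s c := eval (fun i => v (c (+) ~~ row3 i)) g.
have s4 c : s c = eval (fun i => v (c (+) ~~ row4 i)) g.
  exact: (gS (fun b => v (c (+) ~~ b))).
pose t c := eval (fun i => s (c (+) ~~ row1 i)) g.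
have t2 c : t c = eval (fun i => s (c (+) ~~ row2 i)) g.
  exact: (gR (fun b => s (c (+) ~~ b))).
(* Where both pairs split, [A] takes a generator and [B] an [s] value, to fit [wild1] and [wild2],
   each of which leaves the other entry free. *)
pose A (i : letters double_loop_letter) :=
  if (row1 i != row2 i) && (row3 i == row4 i) then s (row1 i) else v (row3 i).
pose B (i : letters double_loop_letter) :=
  if row1 i == row2 i then v (row3 i) else s (row2 i).
pose a := eval A g; pose b := eval B g.
have same_v p c : agen p p (v c) (v (~~ c)).
  rewrite -(free_eval_term p); apply: gen_eval12 => b'.
  by apply: gen_letter; case: b' c => -[].
have same_s p c : agen p p (s c) (s (~~ c)).
  by apply: gen_eval34 => y; rewrite addNb; apply: same_v.
have same_t p c : agen p p (t c) (t (~~ c)).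
  by apply: gen_eval34 => y; rewrite addNb; apply: same_s.
have split_s c z : agen (s c) (s (~~ c)) z z.
  apply: gen_eval12 => y; rewrite -(free_eval_term z); apply: gen_eval34 => b'.
  by rewrite addNb; apply: gen_letter; case: (c (+) _) b' => -[].
have wild1 c q : agen (v c) q (v c) (v (~~ c)).
  move: q; apply: gen_all2 => b'.
  by apply: gen_letter; case: b' c => -[].
have wild2 c p : agen p (s (~~ c)) (s c) (s (~~ c)).
  rewrite -[p](eval_constF g); apply: gen_eval => y; rewrite addNb.
  move: (c (+) _) p => c'; apply: gen_all1 => b'.
  by apply: gen_letter; case: b' c' => -[].
have dl (i : letters double_loop_letter) : row1 i != row2 i \/ row3 i != row4 i.
  by case: i => -[[[b1 b2] b3] b4] Gi; apply/orP.
have neqN (c c' : bool) : c != c' -> c' = ~~ c by case: c c' => -[].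
(* The two equal entries are presented by rows 3 and 4. For [c = false] the rows are exchanged and
   negated, so that a coordinate splitting them reads [row3 i], [~~ row3 i] in either case. *)
have ab_s c : agen a b (s c) (s c).
  have -> : agen a b (s c) (s c) =
      agen a b (eval (fun i => v (if c then row3 i else ~~ row4 i)) g)
               (eval (fun i => v (if c then row4 i else ~~ row3 i)) g).
    case: c => /=.
      by rewrite {1}/s s4; congr agen; congr eval; apply: funext => i; rewrite /= negbK.
    by rewrite {2}/s s4.
  apply: gen_eval => i; rewrite /A /B.
  case: (eqVneq (row3 i) (row4 i)) => [e34 | /neqN e34].
    have r12 : row1 i != row2 i by case: (dl i) => //; rewrite e34 eqxx.
    rewrite r12 (negbTE r12) /= (neqN _ _ r12) -e34.
    by case: c; apply: split_s.
  rewrite e34 negbK andbF; have -> : (if c then row3 i else row3 i) = row3 i by case: c.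
  have -> : (if c then ~~ row3 i else ~~ row3 i) = ~~ row3 i by case: c.
  by case: ifP => _; [apply: same_v | apply: wild1].
have ab_t c : agen a b (t c) (t c) by apply: gen_eval34 => y; apply: ab_s.
have ab_tN c : agen a b (t c) (t (~~ c)).
  have -> : agen a b (t c) (t (~~ c)) =
      agen a b (eval (fun i => s (if c then row1 i else ~~ row2 i)) g)
               (eval (fun i => s (if c then ~~ row1 i else row2 i)) g).
    case: c => /=.
      by congr agen; congr eval; apply: funext => i; rewrite /= ?negbK.
    by rewrite !t2; congr agen; congr eval; apply: funext => i; rewrite /= ?negbK.
  apply: gen_eval => i; rewrite /A /B.
  case: (eqVneq (row1 i) (row2 i)) => [e12 | /neqN e12].
    rewrite -e12 /=; case: c; first exact: same_s.
    by rewrite -[X in agen _ _ _ (s X)]negbK; apply: same_s.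
  rewrite e12 negbK andTb.
  have -> : (if c then row1 i else row1 i) = row1 i by case: c.
  have -> : (if c then ~~ row1 i else ~~ row1 i) = ~~ row1 i by case: c.
  by apply: wild2.
have ab_any c c' : agen a b (t c) (t c').
  by case: (eqVneq c c') => [<- | /neqN ->]; [apply: ab_t | apply: ab_tN].
pose ab c := if c then a else b.
have ab_ne c c' : agen (ab true) (ab false) (t c) (t c') /\
                  agen (ab false) (ab true) (t c) (t c').
  by split; [|apply: gen_swap]; apply: ab_any.
(* Coordinates with equal rows 1 and 2 split rows 3 and 4, as [same_t] requires; at the others [a]
   and [b], in either order, accept any two [t] values. *)
have [h [h1 h2 h3 h4]] : agen (eval (fun i => ab (row1 i)) g)
    (eval (fun i => ab (row2 i)) g) (eval (fun i => t (row3 i)) g)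
    (eval (fun i => t (row4 i)) g).
  apply: gen_eval => i; case: (eqVneq (row1 i) (row2 i)) => [e12 | /neqN ->].
    have /neqN -> : row3 i != row4 i by case: (dl i) => //; rewrite e12 eqxx.
    by rewrite e12; apply: same_t.
  by have [] := ab_ne (row3 i) (row4 i); case: (row1 i).
rewrite (gR ab) in h1; rewrite (gS t) in h3; rewrite h2 in h1; rewrite h4 in h3.
by exists h; split; apply/free_gen_eq; rewrite !eval_subst.
Qed.

End DoubleLoop.

(** * From Taylor terms to the equations *)

(** Coordinates move one at a time, each along its own chain of [R]-steps; in [h s] those listed in
    [s] have been moved. *)
Lemma pointwise_clos_trans (A : Type) (n : nat) (R : relation A)
    (K : ('I_n -> A) -> Prop) :
  (forall i a b, (forall j, j != i -> a j = b j) -> R (a i) (b i) -> K a -> K b) ->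
  forall a b, (forall i, clos_trans A R (a i) (b i)) -> K a -> K b.
Proof.
move=> Kstep a b ab Ka.
pose h (s : seq 'I_n) i := if i \in s then b i else a i.
suff Kh s : K (h s).
  have -> : b = h (enum 'I_n) by apply: funext => i; rewrite /h mem_enum.
  exact: Kh.
elim: s => [|j s IH]; first by have -> : h [::] = a by apply: funext.
case: (boolP (j \in s)) => js.
  have -> // : h (j :: s) = h s.
  by apply: funext => i; rewrite /h inE; case: eqP => // ->; rewrite js.
pose u x i := if i == j then x else h s i.
have -> : h (j :: s) = u (b j).
  by apply: funext => i; rewrite /u /h inE; case: eqP => // ->.
have : K (u (a j)).
  have -> // : u (a j) = h s.
  by apply: funext => i; rewrite /u /h; case: eqP => // ->; rewrite (negbTE js).
elim: (ab j) => [x y xy|x y z _ IHxy _ IHyz /IHxy/IHyz //].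
by apply: (Kstep j); rewrite /u ?eqxx // => k /negbTE ->.
Qed.

Section CongruenceJoins.
Variables (S : signature) (A : algebra S).

Lemma clos_trans_congruence (I : Type) (P : I -> Prop) (G : I -> relation A) :
  (exists i, P i) -> (forall i, P i -> congruence (G i)) ->
  congruence (clos_trans A (fun x y => exists2 i, P i & G i x y)).
Proof.
move=> [i0 Pi0] cG; set R := fun x y => _.
have Rrefl x : clos_trans A R x x.
  by apply: t_step; exists i0 => //; apply: con_refl (cG _ Pi0) _.
split; first split=> //.
- by move=> x y z; apply: t_trans.
- move=> x y; elim=> {x y} [x y [i Pi xy]|x y z _ xy _ yz].
    by apply: t_step; exists i => //; apply: con_sym (cG _ Pi) _ _ xy.
  exact: t_trans xy.
move=> o a b ab; apply: (pointwise_clos_trans (R := R)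
  (K := fun c => clos_trans A R (interp a) (interp c)) _ ab) => // i c d cd [k Pk ck] ac.
apply: t_trans ac _; apply: t_step; exists k => //.
apply: (congruence_compat (cG k Pk)) => j; case: (eqVneq j i) => [-> //|/cd ->].
exact: con_refl (cG k Pk) _.
Qed.

Lemma join_congruence (R R' : relation A) :
  congruence R -> congruence R' -> congruence (join R R').
Proof.
move=> cR cR'.
have -> : join R R' =
    clos_trans A (fun x y => exists2 b : bool, True & (if b then R else R') x y).
  congr clos_trans; apply: funext => x; apply: funext => y; apply: propext.
  split=> [[xy|xy]|[[] _ xy]]; [by exists true|by exists false|by left|by right].
by apply: clos_trans_congruence => [|[]//]; exists true.
Qed.

Lemma bigjoin_congruence (s : seq nat) (G : nat -> relation A) :
  s != [::] -> (forall i, i \in s -> congruence (G i)) -> congruence (bigjoin s G).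
Proof.
move=> s0 cG; apply: clos_trans_congruence => //.
by case: s s0 {cG} => // i s _; exists i; apply: mem_head.
Qed.

Lemma meet_congruence (R R' : relation A) :
  congruence R -> congruence R' -> congruence (meet R R').
Proof.
move=> cR cR'; split; first split.
- by move=> x; split; apply: con_refl.
- by move=> x y z [? ?] [? ?]; split;
    [apply: (con_trans cR)|apply: (con_trans cR')]; eassumption.
- by move=> x y [? ?]; split; apply: con_sym.
- by move=> o a b ab; split; apply: congruence_compat => // i; case: (ab i).
Qed.

Lemma bigmeet_congruence (s : seq nat) (G : nat -> relation A) :
  (forall i, i \in s -> congruence (G i)) -> congruence (bigmeet s G).
Proof.
move=> cG; split; first split.
- by move=> x i /cG /con_refl.
- by move=> x y z xy yz i si; apply: con_trans (xy i si) (yz i si); apply: cG.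
- by move=> x y xy i si; apply: con_sym (xy i si); apply: cG.
- by move=> o a b ab i si; apply: congruence_compat => [|k]; [apply: cG|apply: ab].
Qed.

End CongruenceJoins.

Section LetterTypes.
Implicit Type l : letters aligned_letter.

(* Choosing from each pair of rows an entry that differs from a common value
   [lam] turns a letter into one of the six non-constant triples. *)
Definition lam l := if row1 l != row2 l then row1 l else row3 l.
Definition mid1 l := if row1 l != row2 l then row2 l else lam l.
Definition mid2 l := if row3 l != row4 l then row4 l else lam l.

(** The ordinal [k] stands for the index [k + 1] of the equations. The default branch serves the
    triple [true], [false], [false]; constant triples do not arise from aligned letters. *)
Definition letter_type l : 'I_6 :=
  match lam l, mid1 l, mid2 l with
  | true, true, false => @Ordinal 6 5 isT
  | true, false, true => @Ordinal 6 4 isT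
  | false, true, true => @Ordinal 6 3 isT
  | false, false, true => @Ordinal 6 2 isT
  | false, true, false => @Ordinal 6 1 isT
  | _, _, _ => @Ordinal 6 0 isT
  end.

Lemma letter_type_spec l :
  [/\ lam l = ((letter_type l).+1 \in Lset 1),
      ~~ lam l = ((letter_type l).+1 \in Lset' 1),
      mid1 l = ((letter_type l).+1 \in Rset 1),
      ~~ mid1 l = ((letter_type l).+1 \in Rset' 1) &
      mid2 l = ((letter_type l).+1 \in Rset 2) /\
      ~~ mid2 l = ((letter_type l).+1 \in Rset' 2)].
Proof.
case: l => [[[[b1 b2] b3] b4] Gl]; rewrite /letter_type /mid1 /mid2 /lam.
rewrite /row1 /row2 /row3 /row4 /=.
by case: b1 b2 b3 b4 Gl => [] [] [] [].
Qed.

Lemma letter_type_rows (A : Type) (a b : A) l :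
  [/\ tnth [tuple a; b; b; b; a; a] (letter_type l) = if lam l then a else b,
      tnth [tuple b; a; b; a; b; a] (letter_type l) = if mid1 l then a else b &
      tnth [tuple b; b; a; a; a; b] (letter_type l) = if mid2 l then a else b].
Proof.
rewrite !(tnth_nth a).
case: l => [[[[b1 b2] b3] b4] Gl]; rewrite /letter_type /mid1 /mid2 /lam.
rewrite /row1 /row2 /row3 /row4 /=.
by case: b1 b2 b3 b4 Gl => [] [] [] [].
Qed.

(** This rests on the alignment: if both pairs split, [row1] and [row3] agree. *)
Lemma lam_row3 l : row3 l != row4 l -> lam l = row3 l.
Proof.
case: l => [[[[b1 b2] b3] b4] Gl]; rewrite /lam /row1 /row2 /row3 /row4 /=.
by case: b1 b2 b3 b4 Gl => [] [] [] [].
Qed.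

End LetterTypes.

(** * The congruence equation from two aligned identities *)

Section AlignedEquation.
Variables (T : signature) (B : algebra T) (g : term T (letters aligned_letter)).
Hypothesis g_idem : forall u : B, eval (fun _ => u) g = u.

(** The tuple [p] keeps [z] where the identity changes the variable and takes the common value
    elsewhere. It is [L]-related to the row [r] and [R]-related to the row [r'], on which [g]
    agrees, so [meet L R] relates the values of [g] at [p] and at [r]. The other changes of
    coordinates stay inside [N]. *)
Lemma row_pair_related (r r' lm md : letters aligned_letter -> bool)
    (L R N tau : relation B) (z : letters aligned_letter -> B) (a b : B) :
  (forall e : bool -> B, eval (e \o r) g = eval (e \o r') g) ->
  (forall i, if r i != r' i then lm i = r i /\ md i = r' i else md i = lm i) ->
  congruence L -> congruence R -> congruence N ->
  inclusion B tau N -> inclusion B (meet L R) N -> tau a b ->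
  (forall i, L (z i) (if lm i then a else b)) ->
  (forall i, R (z i) (if md i then a else b)) ->
  N (eval z g) a.
Proof.
move=> grr lmd cL cR cN tauN LRN ab zL zR; pose v (c : bool) := if c then a else b.
have vN c c' : N (v c) (v c').
  by case: c c' => [] []; rewrite /v; try exact: con_refl cN _;
    [|apply: (con_sym cN)]; apply: tauN.
pose p i := if r i != r' i then z i else v (r i).
apply: (con_trans cN (b := eval p g)).
  apply: (con_eval cN) => i; rewrite /p /=; have := lmd i.
  case: ifP => [_ _|_ mdE]; first exact: con_refl cN _.
  apply: (con_trans cN (b := v (lm i))) => //.
  by apply: LRN; split; [apply: zL | rewrite -mdE; apply: zR].
apply: (con_trans cN (b := eval (v \o r) g)); last first.
  by rewrite -[X in N _ X]g_idem; apply: (con_eval cN) => i; apply: (vN _ true).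
apply: LRN; split.
  apply: (con_eval cL) => i; rewrite /p /=; have := lmd i.
  by case: ifP => [_ [<- _]|_ _]; [apply: zL | apply: con_refl cL _].
rewrite grr; apply: (con_eval cR) => i; rewrite /p /=; have := lmd i.
by case: eqVneq => /= [-> _|_ [_ <-]]; [apply: con_refl cR _ | apply: zR].
Qed.

(** Reflexivity of [gamma] puts [meet L (R i)] inside [theta], so one argument covers both
    congruence equations. *)
Lemma aligned_equation (alpha beta : nat -> relation B) (gamma : relation B) :
  (forall e : bool -> B, eval (e \o @row1 _) g = eval (e \o @row2 _) g) ->
  (forall e : bool -> B, eval (e \o @row3 _) g = eval (e \o @row4 _) g) ->
  (forall i, 1 <= i <= 6 -> congruence (alpha i) /\ congruence (beta i)) ->
  (forall u, gamma u u) -> equation alpha beta gamma.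
Proof.
move=> g12 g34 cab rgamma M a b ab.
have calpha (s : seq nat) :
    {subset s <= iota 1 6} -> s != [::] -> congruence (bigjoin s alpha).
  move=> s6 s0; apply: bigjoin_congruence => // i /s6; rewrite mem_iota => i6.
  by case: (cab i i6).
have cbeta (s : seq nat) :
    {subset s <= iota 1 6} -> s != [::] -> congruence (bigjoin s beta).
  move=> s6 s0; apply: bigjoin_congruence => // i /s6; rewrite mem_iota => i6.
  by case: (cab i i6).
have ctau : congruence (tau alpha beta).
  apply: bigmeet_congruence => i; rewrite mem_iota => i6; have [ca cb] := cab i i6.
  exact: join_congruence.
have /fin_all_exists[z zP] : forall k : 'I_6, exists u, alpha k.+1 a u /\ beta k.+1 u b.
  by move=> k; case: (ab k.+1) => [|u]; [rewrite mem_iota; case: k | exists u].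
have tau_ab : tau alpha beta a b.
  move=> i; rewrite mem_iota; case: i => // i i6.
  have [] := zP (Ordinal (i6 : i < 6)) => /= au ub.
  by apply: t_trans; apply: t_step; [left; exact: au | right].
pose L := join (bigjoin (Lset 1) alpha) (bigjoin (Lset' 1) beta).
pose R i := join (bigjoin (Rset i) alpha) (bigjoin (Rset' i) beta).
pose zt (i : letters aligned_letter) := z (letter_type i).
pose c := eval zt g.
have sub (s : seq nat) : all (fun i => i \in iota 1 6) s -> {subset s <= iota 1 6}.
  by move/allP.
have cL : congruence L.
  by apply: join_congruence; [apply: calpha | apply: cbeta] => //; apply: sub.
have cR i : congruence (R i).
  apply: join_congruence; [apply: calpha | apply: cbeta] => //;
    rewrite /Rset /Rset'; case: ifP => // _; exact: sub.
have zrel (s s' : seq nat) (j : letters aligned_letter) (d : bool) :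
    d = ((letter_type j).+1 \in s) -> ~~ d = ((letter_type j).+1 \in s') ->
    congruence (join (bigjoin s alpha) (bigjoin s' beta)) ->
    join (bigjoin s alpha) (bigjoin s' beta) (zt j) (if d then a else b).
  move=> ds ds' cJ; have [au ub] := zP (letter_type j).
  case: d ds ds' => /esym js /esym js'.
    by apply: (con_sym cJ); apply: t_step; left; apply: t_step; exists (letter_type j).+1.
  by apply: t_step; right; apply: t_step; exists (letter_type j).+1.
have cR1 := cR 1; have cR2 := cR 2.
have zL j : L (zt j) (if lam j then a else b).
  by have [] := letter_type_spec j => ? ? _ _ _; apply: zrel.
have zR1 j : R 1 (zt j) (if mid1 j then a else b).
  by have [] := letter_type_spec j => _ _ ? ? _; apply: zrel.
have zR2 j : R 2 (zt j) (if mid2 j then a else b).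
  by have [] := letter_type_spec j => _ _ _ _ [? ?]; apply: zrel.
(* [theta] is not a congruence in general, so the work is done in a congruence [M'] contained in
   [M]. *)
pose N i := join (tau alpha beta) (meet L (R i)); pose M' := bigmeet [:: 1; 2] N.
have cN i : congruence (N i) by apply: join_congruence => //; apply: meet_congruence.
have cM' : congruence M' by apply: bigmeet_congruence.
have M'M : inclusion B M' M.
  move=> u w uw i si; elim: (uw i si) => {u w uw} [u w [uw|[uL uR]]|u w x _ uw _ wx].
  - by apply: t_step; left.
  - by apply: t_step; right; split=> //; exists u.
  - exact: t_trans uw wx.
have tN i : inclusion B (tau alpha beta) (N i) by move=> u w uw; apply: t_step; left.
have mN i : inclusion B (meet L (R i)) (N i) by move=> u w uw; apply: t_step; right.
have ca : M' c a.
  move=> i; rewrite !inE => /orP[/eqP->|/eqP->].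
    apply: (row_pair_related g12 _ cL cR1 (cN 1) (tN 1) (mN 1) tau_ab zL zR1) => l.
    by rewrite /mid1 /lam; case: (row1 l != row2 l).
  apply: (row_pair_related g34 _ cL cR2 (cN 2) (tN 2) (mN 2) tau_ab zL zR2) => l.
  by rewrite /mid2; case: (boolP (row3 l != row4 l)) => // /lam_row3.
have ab' : M' a b by move=> i _; apply: tN.
have iotaP (l : letters aligned_letter) : (letter_type l).+1 \in iota 1 6.
  by rewrite mem_iota; case: letter_type.
have c6 : iota 1 6 != [::] by [].
apply: (t_trans _ _ _ c); apply: t_step; [left|right]; split.
- rewrite -[X in bigjoin _ _ X]g_idem; apply: con_eval => [|l]; first exact: calpha.
  by have [? ?] := zP (letter_type l); apply: t_step; exists (letter_type l).+1;
    [apply: iotaP|].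
- by apply: M'M; apply: (con_sym cM').
- rewrite -[X in bigjoin _ _ _ X]g_idem; apply: con_eval => [|l]; first exact: cbeta.
  by have [? ?] := zP (letter_type l); apply: t_step; exists (letter_type l).+1;
    [apply: iotaP|].
- by apply: M'M; apply: (con_trans cM') ab'.
Qed.

End AlignedEquation.

(** * Generated varieties and idempotent reducts *)

Lemma generated_sub (S : signature) (K : algebra S -> Prop) A : K A -> generated K A.
Proof. by move=> KA W _; apply. Qed.

Lemma generated_sat (S : signature) (K : algebra S -> Prop) (X : countType)
    (p q : term S X) :
  class_sat K p q -> class_sat (generated K) p q.
Proof.
move=> Kpq A genA e.
have satA (p' q' : term S nat) : class_sat K p' q' -> sat A p' q'.
  apply: (genA (fun B => forall p' q' : term S nat, class_sat K p' q' -> sat B p' q')).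
    by exists (class_sat K (X := nat)).
  by move=> B KB p'' q''; apply.
(* Numbers that code no variable are sent to [eval e p], an element available even when [X] is
   empty. *)
have ek r : eval e r = eval (fun k => if unpickle k is Some x then e x else eval e p)
    (subst r (fun x => Var (pickle x))).
  by rewrite eval_subst; congr eval; apply: funext => x /=; rewrite pickleK.
rewrite [LHS]ek [RHS]ek; apply: satA => B KB e'; rewrite !eval_subst; exact: Kpq.
Qed.

Lemma class_sat_sub (S : signature) (K K' : algebra S -> Prop) (X : Type)
    (p q : term S X) :
  (forall A, K A -> K' A) -> class_sat K' p q -> class_sat K p q.
Proof. by move=> KK pq A /KK; apply: pq. Qed.

Lemma taylor_term_generated (S : signature) (K : algebra S -> Prop) n (f : term S 'I_n) :
  taylor_term K f -> taylor_term (generated K) f.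
Proof.
move=> [fi ft]; split; first exact: generated_sat.
by move=> i; have [x [y [xy fxy]]] := ft i; exists x, y; split=> //; apply: generated_sat.
Qed.

Lemma taylor_term_sub (S : signature) (K K' : algebra S -> Prop) n (f : term S 'I_n) :
  (forall A, K A -> K' A) -> taylor_term K' f -> taylor_term K f.
Proof.
move=> KK [fi ft]; split; first exact: class_sat_sub fi.
move=> i; have [x [y [xy fxy]]] := ft i; exists x, y; split=> //.
exact: class_sat_sub fxy.
Qed.

Section IdempotentReduct.
Variables (S : signature) (V : algebra S -> Prop).

Definition reducts (B : algebra (idem_signature V)) :=
  exists2 A, V A & B = idem_reduct V A.

Lemma idempotent_eval n (t : term S 'I_n) (A : algebra S) (a : A) :
  Defs.idempotent V t -> V A -> eval (fun _ => a) t = a.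
Proof.
move=> ti VA; have := ti A VA (fun _ => a); by rewrite eval_subst.
Qed.

Lemma reducts_idem B : reducts B ->
  forall (o : idem_signature V) (a : B), interp (fun _ : 'I_(arity o) => a) = a.
Proof.
move=> [A VA ->] o a /=; apply: idempotent_eval VA; exact: idem_termP.
Qed.

Lemma taylor_term_reducts n (f : term S 'I_n) (ft : taylor_term V f) :
  taylor_term reducts
    (@App (idem_signature V) 'I_n (IdempotentTerm (proj1 ft)) Var).
Proof.
split; first by move=> B RB e /=; apply: (reducts_idem RB).
move=> i; have [x [y [xy fxy]]] := proj2 ft i; exists x, y; split=> //.
move=> B [A VA ->] e /=.
by have := fxy A VA e; rewrite !eval_subst.
Qed.

Lemma congruence_reduct (A : algebra S) (D : relation A) :
  congruence D -> congruence (D : relation (idem_reduct V A)).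
Proof.
move=> cD; split; first by case: cD.
by move=> o a b ab /=; apply: con_eval.
Qed.

Lemma taylor_abelian_idem : taylor V -> taylor (@abelian_idem_variety S V).
Proof.
move=> [n [f ft]]; exists n.
exists (@App (idem_signature V) 'I_n (IdempotentTerm (proj1 ft)) Var).
have tr := taylor_term_generated (taylor_term_reducts ft).
by apply: taylor_term_generated; apply: taylor_term_sub tr => B [].
Qed.

End IdempotentReduct.

Lemma taylor_term_bool (S : signature) (W : algebra S -> Prop) n (f : term S 'I_n) :
  taylor_term W f -> forall l : 'I_n, exists rho sigma : 'I_n -> bool,
  rho l <> sigma l /\
  class_sat W (subst f (fun i => Var (rho i))) (subst f (fun i => Var (sigma i))).
Proof.
move=> [_ ft] l; have [x [y [xy fxy]]] := ft l.
exists (fun i => x i == ord0), (fun i => y i == ord0); split.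
  by move: xy; case: (x l) => -[|[|//]] ?; case: (y l) => -[|[|//]] ? // [];
    apply: val_inj.
by move=> A WA e; have := fxy A WA (fun k => e (k == ord0)); rewrite !eval_subst.
Qed.

Lemma taylor_equation (S : signature) (V : algebra S -> Prop) : taylor V ->
  forall A, V A -> forall alpha beta : nat -> relation A,
  (forall i, 1 <= i <= 6 -> congruence (alpha i) /\ congruence (beta i)) ->
  forall gamma : relation A, (forall u, gamma u u) -> equation alpha beta gamma.
Proof.
move=> [n [f ft]] A VA alpha beta cab gamma rgamma.
have RA : reducts (idem_reduct V A) by exists A.
have Ridem := @reducts_idem S V.
have [g [g12 g34]] := aligned_loop Ridem (taylor_term_bool (taylor_term_reducts ft)).
apply: (@aligned_equation _ (idem_reduct V A) g) => //.
- by move=> u; apply: eval_const RA.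
- by move=> e; have := g12 _ RA e; rewrite !eval_subst.
- by move=> e; have := g34 _ RA e; rewrite !eval_subst.
- by move=> i i6; have [ca cb] := cab i i6; split; apply: congruence_reduct.
Qed.

Lemma taylor_commutator_equation (S : signature) (V : algebra S -> Prop) :
  taylor V -> satisfies_commutator_equation V.
Proof.
move=> tV A VA alpha beta cab; apply: (taylor_equation tV VA) => // u.
exact: con_refl (commutator_congruence _ _) u.
Qed.

Lemma taylor_herringbone_equation (S : signature) (V : algebra S -> Prop) :
  taylor V -> satisfies_herringbone_equation V 0.
Proof.
move=> tV A VA alpha beta cab; apply: (taylor_equation tV VA) => // u; split.
  move=> i; rewrite mem_iota => i5; apply: t_step; left.
  by have [] := cab i; [lia|move=> /con_refl].
by have [_ /con_refl] := cab 6 isT; apply.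
Qed.

(** * Commutators and abelian quotients of congruence classes *)

Lemma eq_congruence (S : signature) (A : algebra S) : congruence (@eq A).
Proof.
split; first by split=> // ? ? ? -> ->.
by move=> o a b ab; congr interp; apply: funext.
Qed.

Lemma commutator_sub (S : signature) (A : algebra S) (D : relation A) :
  congruence D -> inclusion A (commutator D D) D.
Proof.
move=> cD; apply: commutator_least => // n m f [p fE] a b u v ab uv _.
rewrite !fE; apply: (con_eval cD) => -[i|c]; last exact: con_refl cD _.
by rewrite /concat; case: split => [j|k] //; apply: con_refl cD _.
Qed.

(** Each of the two blocks of arguments receives a full copy of [X], and [var] selects a copy
    according to [P]; this avoids enumerating [P] and its complement separately. *)
Lemma centralizes_eval (S : signature) (A : algebra S) (al be de : relation A)
    (X : finType) (t : term S X) (P : pred X) (a b u v : X -> A) :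
  centralizes al be de ->
  (forall x, al (a x) (b x)) -> (forall x, be (u x) (v x)) ->
  de (eval (fun x => if P x then a x else u x) t)
     (eval (fun x => if P x then a x else v x) t) ->
  de (eval (fun x => if P x then b x else u x) t)
     (eval (fun x => if P x then b x else v x) t).
Proof.
move=> C ab uv.
pose N := #|X|.
pose var x := if P x then lshift N (enum_rank x) else rshift N (enum_rank x).
pose h (w : 'I_(N + N) -> A) := eval (fun x => w (var x)) t.
have hE c w : h (concat (c \o enum_val) (w \o enum_val)) =
    eval (fun x => if P x then c x else w x) t.
  congr eval; apply: funext => x; rewrite /concat /var.
  case: ifP => _; first by rewrite (unsplitK (inl (enum_rank x))) /= enum_rankK.
  by rewrite (unsplitK (inr (enum_rank x))) /= enum_rankK.
rewrite -!hE; apply: C => [|i|j]; [|exact: ab|exact: uv].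
exists (subst t (fun x => Var (inl (var x)))) => w.
by rewrite eval_subst.
Qed.

Lemma sq_sat_related (S : signature) (A : algebra S) (D : relation A) (U : A -> Prop)
    cD (Uc : forall (o : S) (a : 'I_(arity o) -> A), (forall i, U (a i)) -> U (interp a))
    (Us : forall a b, U a -> D a b -> U b) (X : Type) (p q : term S X) (e : X -> A) :
  sat (subquotient cD Uc Us) p q -> (forall x, U (e x)) -> D (eval e p) (eval e q).
Proof.
move=> pq Ue; pose e' x : subquotient cD Uc Us := sq_inj cD Us (Ue x).
have ee' r : D (eval e r) (sval (eval e' r)).
  apply: (con_trans cD) (sq_eval e' r); apply: (con_eval cD) => x.
  exact: crepP.
by apply: (con_trans cD (ee' p)); rewrite (pq e'); apply: (con_sym cD).
Qed.

Section Flatten.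
Variables (S : signature) (V : algebra S -> Prop).

Fixpoint unfold_idem (X : Type) (t : term (idem_signature V) X) : term S X :=
  match t with
  | Var x => Var x
  | App o ts => subst (idem_term o) (fun i => unfold_idem (ts i))
  end.

Lemma eval_unfold_idem (X : Type) (A : algebra S) (e : X -> A) t :
  eval e (unfold_idem t) = eval (e : X -> idem_reduct V A) t.
Proof.
elim: t => //= o ts IH; rewrite eval_subst; congr eval; exact: funext.
Qed.

End Flatten.

Section AbelianSubquotient.
Variables (S : signature) (V : algebra S -> Prop) (A : algebra S).
Hypothesis VA : V A.
Variables (D : relation A) (a0 : A).
Hypothesis cD : congruence D.

Let C := commutator D D.
Let cC : congruence (C : relation (idem_reduct V A)).
Proof. exact/congruence_reduct/commutator_congruence. Qed.

(** Congruence classes are subalgebras because the operations of the reduct are idempotent. *)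
Lemma class_closed (o : idem_signature V) (a : 'I_(arity o) -> idem_reduct V A) :
  (forall i, D a0 (a i)) -> D a0 (interp a).
Proof.
move=> Da; have RA : reducts (idem_reduct V A) by exists A.
rewrite -(reducts_idem RA o a0); exact: (congruence_compat (congruence_reduct V cD)).
Qed.

Lemma class_saturated (a b : idem_reduct V A) : D a0 a -> C a b -> D a0 b.
Proof. by move=> a0a /(commutator_sub cD); apply: (con_trans cD a0a). Qed.

Definition class_quotient := subquotient cC class_closed class_saturated.

Lemma class_quotient_reduct : idem_reduct_variety class_quotient.
Proof.
move=> W [Sigma WE] KW; apply/WE => p q Spq; apply: sq_sat => e _.
have /WE/(_ _ _ Spq) -> : W (idem_reduct V A) by apply: KW; exists A.
exact: con_refl cC _.
Qed.

(** Any two elements of the class are [D]-related, so the term condition for [D] modulo [C] in [A]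
    becomes the term condition for the total congruence modulo equality. Polynomials are unfolded to
    [A], with representatives as constants. *)
Lemma class_quotient_abelian : abelian class_quotient.
Proof.
move=> x y; split=> [|->]; last exact: con_refl (commutator_congruence _ _) _.
apply: commutator_least => [|n m f [p fE] a b u v _ _]; first exact: eq_congruence.
rewrite !sq_eqP => H.
pose q : term S ('I_(n + m) + A) := subst (unfold_idem p)
  (fun k => Var (match k with inl i => inl i | inr c => inr (sval c) end)).
pose h (w : 'I_(n + m) -> A) :=
  eval (fun k => match k with inl i => w i | inr c => c end) q.
have hE (c : 'I_n -> class_quotient) (w : 'I_m -> class_quotient) :
    C (h (concat (fun i => sval (c i)) (fun j => sval (w j)))) (sval (f (concat c w))).
  rewrite fE; apply: (con_trans cC) (sq_eval _ _).
  rewrite /h eval_subst eval_unfold_idem.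
  apply: (con_eval cC) => -[i|k] /=; last exact: con_refl cC _.
  by rewrite /concat; case: split => j; exact: con_refl cC _.
apply: (con_trans cC) (hE b v); apply: (con_trans cC (con_sym cC (hE b u))).
have Dall (k k' : class_quotient) : D (sval k) (sval k').
  by apply: (con_trans cD (b := a0)); [apply: (con_sym cD)|];
    [case: k => k []|case: k' => k' []].
apply: (commutator_centralizes (n := n) (m := m) (f := h)) (fun i => Dall _ _) _ _.
- by exists q.
- by move=> j; apply: Dall.
apply: (con_trans cC) (con_sym cC (hE a v)); exact: (con_trans cC (hE a u)).
Qed.

End AbelianSubquotient.

Section CommutatorIdentities.
Variables (S : signature) (V : algebra S -> Prop).

Lemma abelian_idem_variety_idem (B : algebra (idem_signature V)) :
  abelian_idem_variety B ->
  forall (o : idem_signature V) (a : B), interp (fun _ : 'I_(arity o) => a) = a.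
Proof.
move=> WB o a.
suff: class_sat (@abelian_idem_variety S V) (App o (fun _ => Var tt)) (Var tt).
  by move=> /(_ B WB (fun _ => a)).
apply: generated_sat; apply: (class_sat_sub (K' := @idem_reduct_variety S V)).
  by move=> C [].
by apply: generated_sat => C RC e /=; apply: reducts_idem RC _ _.
Qed.

(** At a coordinate with [r i = r' i] both sides carry the same value, and the term condition allows
    replacing it by that of [lm i]; at the other coordinates [lm] and [md] already are [r] and
    [r']. *)
Lemma row_pair_commutator (A : algebra S) (C : relation A) (D : relation A)
    (t : term S (letters aligned_letter)) (r r' lm md : letters aligned_letter -> bool)
    (v : bool -> A) :
  congruence C -> centralizes D D C -> (forall c c', D (v c) (v c')) ->
  (forall i, if r i != r' i then lm i = r i /\ md i = r' i else md i = lm i) ->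
  C (eval (v \o r) t) (eval (v \o r') t) ->
  C (eval (v \o lm) t) (eval (v \o md) t).
Proof.
move=> cC CDD Dv lmd rr.
have := centralizes_eval (t := t) (P := fun i => r i == r' i) (a := v \o r)
  (b := v \o lm) (u := v \o r) (v := v \o r') CDD (fun i => Dv _ _) (fun i => Dv _ _).
have mE p q s : (forall i, (if r i == r' i then p i else q i) = s i) ->
    (fun i => if r i == r' i then (v \o p) i else (v \o q) i) = v \o s.
  by move=> ps; apply: funext => i /=; rewrite -ps; case: ifP.
rewrite (mE r r r) ?(mE r r' r') ?(mE lm r lm) ?(mE lm r' md); first exact.
- by move=> i; have := lmd i; case: eqP => /= [_ ->|_ [_ ->]].
- by move=> i; have := lmd i; case: eqP => //= _ [->].
- by move=> i; case: eqP => [->|].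
- by move=> i; case: ifP.
Qed.

Lemma taylor_abelian_idem_term : taylor (@abelian_idem_variety S V) ->
  let x : term S 'I_2 := Var ord0 in
  let y : term S 'I_2 := Var ord_max in
  exists t : term S 'I_6,
    [/\ class_comm_sat V (app6 t x y y y x x) (app6 t y x y x y x),
        class_comm_sat V (app6 t y x y x y x) (app6 t y y x x x y) &
        class_comm_sat V (app6 t x x x x x x) x].
Proof.
move=> [n [f ft]] x y.
have [g [g12 g34]] := aligned_loop abelian_idem_variety_idem (taylor_term_bool ft).
pose t := subst (unfold_idem g) (fun l => Var (letter_type l)).
have rows (A : algebra S) (D : relation A) (a : 'I_2 -> A) : V A -> congruence D ->
    (forall i j, D (a i) (a j)) ->
    let C := commutator D D in
    C (eval a (app6 t x y y y x x)) (eval a (app6 t y x y x y x)) /\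
    C (eval a (app6 t x y y y x x)) (eval a (app6 t y y x x x y)).
  move=> VA cD Da C; pose v (c : bool) := if c then a ord0 else a ord_max.
  have Dv c c' : D (v c) (v c') by case: c c' => [] []; apply: Da.
  have cC : congruence C := commutator_congruence _ _.
  have [E1 E2 E3] : [/\ eval a (app6 t x y y y x x) = eval (v \o lam) (unfold_idem g),
      eval a (app6 t y x y x y x) = eval (v \o mid1) (unfold_idem g) &
      eval a (app6 t y y x x x y) = eval (v \o mid2) (unfold_idem g)].
    by split; rewrite eval_app6 eval_subst; congr eval; apply: funext => l /=;
      have [] := letter_type_rows (a ord0) (a ord_max) l.
  rewrite E1 E2 E3.
  have WB : abelian_idem_variety (class_quotient VA (v true) cD).
    apply: generated_sub; split; first exact: class_quotient_reduct.
    exact: class_quotient_abelian.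
  have vrow (r r' : letters aligned_letter -> bool) :
      class_sat (@abelian_idem_variety S V) (subst g (fun l => Var (r l)))
        (subst g (fun l => Var (r' l))) ->
      C (eval (v \o r) (unfold_idem g)) (eval (v \o r') (unfold_idem g)).
    move=> rr; rewrite !eval_unfold_idem.
    have := sq_sat_related (e := (v : bool -> idem_reduct V A)) (rr _ WB) (Dv _).
    by rewrite !eval_subst.
  have CDD : centralizes D D C := commutator_centralizes (alpha := D) (beta := D).
  split; apply: row_pair_commutator cC CDD Dv _ (vrow _ _ _); [|exact: g12| |exact: g34].
    by move=> l; rewrite /mid1 /lam; case: (row1 l != row2 l).
  by move=> l; rewrite /mid2; case: (boolP (row3 l != row4 l)) => // /lam_row3.
exists t; split=> A VA D cD a Da.
- by have [] := rows A D a VA cD Da.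
- have [C1 C2] := rows A D a VA cD Da.
  have cC := commutator_congruence D D.
  exact: (con_trans cC (con_sym cC C1) C2).
(* Here the two sides are equal, since [g] is composed of idempotent terms. *)
rewrite eval_app6_diag eval_subst eval_unfold_idem.
rewrite (eval_const (@reducts_idem S V)); last by exists A.
exact: con_refl (commutator_congruence _ _) _.
Qed.

End CommutatorIdentities.

(** * Failure of the equations without a Taylor term *)

Lemma taylor_finType (S : signature) (V : algebra S -> Prop) (X : finType)
    (f : term S X) :
  (forall A : algebra S, V A -> forall a : A, eval (fun _ => a) f = a) ->
  (forall x, exists e e' : X -> bool, e x <> e' x /\
    class_sat V (subst f (fun y => Var (e y))) (subst f (fun y => Var (e' y)))) ->
  taylor V.
Proof.
move=> f_idem f_taylor; exists #|X|, (subst f (fun x => Var (enum_rank x))); split.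
  by move=> A VA e; rewrite !eval_subst /= f_idem.
move=> i; have [e [e' [ee fee]]] := f_taylor (enum_val i).
pose c (b : bool) : 'I_2 := if b then ord0 else ord_max.
exists (fun j => c (e (enum_val j))), (fun j => c (e' (enum_val j))); split.
  by move: ee; case: (e _) (e' _) => [] [].
move=> A VA E; have := fee A VA (E \o c); rewrite !eval_subst => H.
by congr (_ = _): H; congr eval; apply: funext => x /=; rewrite enum_rankK.
Qed.

(** * Minor-preserving choice of coordinates *)

Section MinorChoice.
Variables (S : signature) (V : algebra S -> Prop) (N : nat).
Hypothesis not_taylor : ~ taylor V.

Definition idem_word := {p : term S 'I_N.+1 | Defs.idempotent V p}.
Implicit Types (p q : idem_word) (s : seq idem_word).

Definition minor_eq (p q : term S 'I_N.+1) (e e' : 'I_N.+1 -> bool) :=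
  class_sat V (subst p (fun i => Var (e i))) (subst q (fun i => Var (e' i))).

Lemma Var_idempotent i : Defs.idempotent V (Var i : term S 'I_N.+1).
Proof. by move=> A VA e. Qed.

Definition var0 : idem_word := exist _ (Var ord0) (Var_idempotent ord0).

(** The iterated star product; its variables are the lists of coordinates taken in the successive
    factors. *)
Fixpoint star s : term S (seq 'I_N.+1) :=
  if s is p :: s' then
    subst (sval p) (fun k => subst (star s') (fun w => Var (k :: w)))
  else Var [::].

Lemma star_idem s (A : algebra S) (a : A) : V A -> eval (fun _ => a) (star s) = a.
Proof.
move=> VA; elim: s => //= p s IH; rewrite eval_subst.
rewrite -[RHS](idempotent_eval _ (svalP p) VA); congr eval; apply: funext => k.
by rewrite eval_subst.
Qed.

(** If only the [i]-th entry of each list is read, all other factors have constant arguments and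
    disappear by idempotence. *)
Lemma star_eval s i (A : algebra S) (u : 'I_N.+1 -> A) : V A -> i < size s ->
  eval (fun w => u (nth ord0 w i)) (star s) = eval u (sval (nth var0 s i)).
Proof.
move=> VA; elim: s i => //= p s IH [_|i]; rewrite eval_subst.
  by congr eval; apply: funext => k; rewrite eval_subst /= star_idem.
rewrite ltnS => /IH {}IH; rewrite -[RHS](idempotent_eval _ (svalP p) VA).
by congr eval; apply: funext => k; rewrite eval_subst /=.
Qed.

(* The star product of finitely many idempotent terms without a consistent
   choice of coordinates is a Taylor term. *)
Lemma finite_minor_choice s : exists phi : nat -> 'I_N.+1,
  forall i j e e', i < size s -> j < size s ->
  minor_eq (sval (nth var0 s i)) (sval (nth var0 s j)) e e' ->
  e (phi i) = e' (phi j).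
Proof.
apply: contrapT => no_phi; apply: not_taylor.
pose X := {ffun 'I_(size s) -> 'I_N.+1}.
pose toX (w : seq 'I_N.+1) : X := [ffun i : 'I_(size s) => nth ord0 w i].
apply: (@taylor_finType S V X (subst (star s) (fun w => Var (toX w)))).
  by move=> A VA a; rewrite eval_subst /= star_idem.
(* A coordinate [x] of the star product is itself a candidate choice; a minor identity that it
   violates is the Taylor identity required at [x]. *)
move=> x; apply: contrapT => no_e; apply: no_phi.
exists (fun i => if insub i is Some k then x k else ord0) => i j e e' lti ltj m.
apply: contrapT => ne; apply: no_e.
pose i' := Ordinal lti; pose j' := Ordinal ltj.
exists (fun y : X => e (y i')), (fun y : X => e' (y j')); split.
  by move: ne; rewrite !insubT.
move=> A VA E; rewrite !eval_subst /=.
have toXE k (ltk : k < size s) w : toX w (Ordinal ltk) = nth ord0 w k by rewrite ffunE.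
have := m A VA E; rewrite !eval_subst /= => H.
transitivity (eval (fun w => E (e (nth ord0 w i))) (star s)).
  by congr eval; apply: funext => w; rewrite toXE.
rewrite (star_eval (fun k => E (e k)) VA lti) H -(star_eval (fun k => E (e' k)) VA ltj).
by congr eval; apply: funext => w; rewrite toXE.
Qed.

Definition listed p s := exists2 i, i < size s & nth var0 s i = p.

Lemma listed_choice s : exists phi : idem_word -> 'I_N.+1,
  forall p q e e', listed p s -> listed q s ->
  minor_eq (sval p) (sval q) e e' -> e (phi p) = e' (phi q).
Proof.
have [phi phiP] := finite_minor_choice s.
have /choice[ind indP] p : exists i, listed p s -> i < size s /\ nth var0 s i = p.
  by case: (pselect (listed p s)) => [[i lti <-]|nl]; [exists i | exists 0].
exists (phi \o ind) => p q e e' /indP[ltp pE] /indP[ltq qE] m.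
by apply: phiP => //; rewrite pE qE.
Qed.

Local Open Scope classical_set_scope.

Lemma idem_word_choice : exists phi : idem_word -> 'I_N.+1,
  forall p q e e', minor_eq (sval p) (sval q) e e' -> e (phi p) = e' (phi q).
Proof.
(* A set is in this filter if it contains all lists that extend some fixed finite list of words. *)
pose F : set_system (seq idem_word) :=
  fun P => exists s, forall s', (forall p, listed p s -> listed p s') -> P s'.
have listed_cat p s s' : listed p s \/ listed p s' -> listed p (s ++ s').
  case=> [[i lti <-]|[i lti <-]].
    by exists i; rewrite ?nth_cat ?lti // size_cat; lia.
  exists (size s + i); rewrite ?size_cat ?ltn_add2l // nth_cat.
  by rewrite ltnNge leq_addr addKn.
have FF : ProperFilter F.
  apply: Build_ProperFilter_ex; last split.
  - by move=> P [s Ps]; exists s; apply: Ps.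
  - by exists [::].
  - move=> P Q [s Ps] [s' Qs']; exists (s ++ s') => r sr; split.
      by apply: Ps => p ps; apply/sr/listed_cat; left.
    by apply: Qs' => p ps; apply/sr/listed_cat; right.
  - by move=> P Q PQ [s Ps]; exists s => s' ss'; apply/PQ/Ps.
have [U [UU FU]] := ultraFilterLemma FF.
have /choice[phi phiP] := listed_choice.
(* The values lie in a finite set, so exactly one of them is taken on a set of the ultrafilter. *)
have /choice[psi psiP] p : exists k, U [set s | phi s p = k].
  suff [r [rs rU]] : exists r : seq 'I_N.+1, True /\ U [set s | phi s p \in r].
    elim: r rU {rs} => [/filter_ex[s] //|k r IH rU].
    have [Uk|Uk] := in_ultra_setVsetC [set s | phi s p = k] UU; first by exists k.
    apply: IH; apply: filterS (filterI rU Uk) => s /= [].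
    by rewrite inE => /predU1P[].
  exists (enum 'I_N.+1); split=> //; apply: filterS (filterT) => s _ /=.
  by rewrite mem_enum.
exists psi => p q e e' m.
have Ul r : U (listed r).
  apply: FU; exists [:: r] => s; apply; by exists 0.
have [s [[sp sq] [lp lq]]] :=
  filter_ex (filterI (filterI (psiP p) (psiP q)) (filterI (Ul p) (Ul q))).
by rewrite -sp -sq; apply: phiP m.
Qed.

Local Close Scope classical_set_scope.

Theorem minor_choice : exists psi : term S 'I_N.+1 -> 'I_N.+1,
  forall (p q : term S 'I_N.+1) e e', Defs.idempotent V p -> Defs.idempotent V q ->
  minor_eq p q e e' -> e (psi p) = e' (psi q).
Proof.
have [phi phiP] := idem_word_choice.
have /choice[psi psiP] (p : term S 'I_N.+1) :
    exists k, forall ip : Defs.idempotent V p, k = phi (exist _ p ip).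
  (* The choice is made total on terms; [ord0] is an arbitrary value at terms that are not
     idempotent. *)
  case: (pselect (Defs.idempotent V p)) => [ip|nip]; last by exists ord0.
  by exists (phi (exist _ p ip)) => ip'; rewrite (Prop_irrelevance ip ip').
exists psi => p q e e' ip iq m; rewrite (psiP p ip) (psiP q iq).
exact: phiP.
Qed.

End MinorChoice.

(** * Herringbone upper bound for the commutator *)

Section Herringbone.
Variables (S : signature) (A : algebra S) (al be ga : relation A).
Hypotheses (cal : congruence al) (cbe : congruence be) (cga : congruence ga).

Let Y n := herringbone n al be ga.
Let Z n := herringbone n al ga be.

Lemma herringbone_congruence n : congruence (Y n) /\ congruence (Z n).
Proof.
by elim: n => [|n [cY cZ]]; split=> //=; apply: join_congruence => //;
  apply: meet_congruence.
Qed.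

Lemma herringboneS n : inclusion A (Y n) (Y n.+1) /\ inclusion A (Z n) (Z n.+1).
Proof.
have mono (R R' R'' : relation A) : inclusion A R R' ->
    inclusion A (join R'' (meet al R)) (join R'' (meet al R')).
  move=> RR u w; elim=> {u w} [u w [uw|[aw uw]]|u w x _ uw _ wx].
  - by apply: t_step; left.
  - by apply: t_step; right; split=> //; apply: RR.
  - exact: t_trans uw wx.
elim: n => [|n [IY IZ]]; last by split; apply: mono.
by split=> u w uw; apply: t_step; left.
Qed.

Lemma herringbone_le m n : m <= n -> inclusion A (Y m) (Y n).
Proof.
move=> /subnKC <-; elim: (n - m) => [|k IH]; first by rewrite addn0.
by rewrite addnS => u w /IH; apply: (herringboneS _).1.
Qed.

(* The chain interleaves with the one obtained by exchanging [be] and [ga], so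
   that the term condition can be transported along [be] and [ga] alike. *)
Definition herringbone_union : relation A := fun u w => exists n, meet al (Y n) u w.

Lemma herringbone_unionZ n u w : meet al (Z n) u w -> herringbone_union u w.
Proof. by move=> [auw Zuw]; exists n.+1; split=> //; apply: t_step; right. Qed.

Lemma herringbone_union_congruence : congruence herringbone_union.
Proof.
split; first split.
- by move=> u; exists 0; split; apply: con_refl.
- move=> u w x [m [uw Yuw]] [n [wx Ywx]]; exists (m + n); split.
    exact: (con_trans cal) uw wx.
  apply: (con_trans (herringbone_congruence (m + n)).1).
    exact: herringbone_le (leq_addr n m) _ _ Yuw.
  exact: herringbone_le (leq_addl m n) _ _ Ywx.
- move=> u w [n [uw Yuw]]; exists n; split; first exact: con_sym.
  exact: con_sym (herringbone_congruence n).1 _ _ Yuw.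
(* Arities are finite, so one level of the chain contains all argument pairs. *)
move=> o a b /fin_all_exists[n nP]; exists (\max_i n i); split.
  by apply: congruence_compat => // i; case: (nP i).
apply: (congruence_compat (herringbone_congruence _).1) => i.
by apply: herringbone_le (leq_bigmax i) _ _ _; case: (nP i).
Qed.

(** The arguments pass from [a] to [b] by single steps along [be] or [ga]. A [be]-step stays inside
    [Y k.+1], a [ga]-step inside [Z k.+1], which meets [al] inside the next [Y]; the [al] part
    always holds because [u] and [v] are [al]-related. *)
Lemma herringbone_centralizes (D : relation A) :
  inclusion A D al -> inclusion A D (join be ga) ->
  centralizes D D herringbone_union.
Proof.
move=> Dal Dbg n m f [p fE] a b u v ab uv.
have fal c : al (f (concat c u)) (f (concat c v)).
  rewrite !fE; apply: (con_eval cal) => -[i|k]; last exact: con_refl cal _.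
  rewrite /concat; case: split => j; first exact: con_refl cal _.
  exact: Dal.
have fstep (R : relation A) (cR : congruence R) i (c d : 'I_n -> A) w :
    (forall j, j != i -> c j = d j) -> R (c i) (d i) ->
    R (f (concat c w)) (f (concat d w)).
  move=> cd Ri; rewrite !fE; apply: (con_eval cR) => -[j|k]; last exact: con_refl cR _.
  rewrite /concat; case: split => l; last exact: con_refl cR _.
  by case: (eqVneq l i) => [-> //|/cd ->]; apply: con_refl cR _.
apply: (pointwise_clos_trans (R := union A be ga)
  (K := fun c => herringbone_union (f (concat c u)) (f (concat c v)))) => [|i];
  last exact: Dbg.
move=> i c d cd [bi|gi] [k [alk Yk]].
  exists k.+1; split=> //.
  have cY := (herringbone_congruence k.+1).1.
  have st w : Y k.+1 (f (concat c w)) (f (concat d w)).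
    by apply: t_step; left; apply: (fstep be cbe i).
  apply: (con_trans cY) (st v); apply: (con_trans cY (con_sym cY (st u))).
  exact: (herringboneS k).1.
apply: (herringbone_unionZ (n := k.+1)); split=> //.
have cZ := (herringbone_congruence k.+1).2.
have st w : Z k.+1 (f (concat c w)) (f (concat d w)).
  by apply: t_step; left; apply: (fstep ga cga i).
apply: (con_trans cZ) (st v); apply: (con_trans cZ (con_sym cZ (st u))).
by apply: t_step; right.
Qed.

End Herringbone.

(* The generators 0, 1, ..., 6, 7 of the free algebra are x, z_1, ..., z_6, y. *)
Section Collapse.
Variables (S : signature) (V : algebra S -> Prop).
Hypothesis not_taylor : ~ taylor V.

Notation F := (free_algebra V 'I_8).
Implicit Types (c : nat -> nat) (u w : F) (i : nat).

Definition psi : term S 'I_8 -> 'I_8 := sval (cid (minor_choice 7 not_taylor)).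

Lemma psiP (p q : term S 'I_8) (e e' : 'I_8 -> bool) :
  Defs.idempotent V p -> Defs.idempotent V q -> minor_eq V p q e e' ->
  e (psi p) = e' (psi q).
Proof. exact: (svalP (cid (minor_choice 7 not_taylor))). Qed.

Definition collapse i (t k : 'I_8) := if k == i :> nat then t else k.

(** The kernel of the endomorphism of [F] that sends generator [i] to [t] and fixes the other
    generators. *)
Definition subst_kernel i (t : 'I_8) : relation F := fun u w =>
  class_sat V (subst (free_term u) (fun k => Var (collapse i t k)))
              (subst (free_term w) (fun k => Var (collapse i t k))).

Definition alpha i := subst_kernel i ord0.
Definition beta i := subst_kernel i ord_max.

Lemma subst_kernel_congruence i t : congruence (subst_kernel i t).
Proof.
split; first split.
- by move=> u.
- by move=> u w x; apply: class_sat_trans.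
- by move=> u w; apply: class_sat_sym.
move=> o a b ab.
have E (e : 'I_(arity o) -> F) := free_eval e (App o Var).
apply: class_sat_trans (class_sat_subst (class_sat_sym (E a)) (fun _ => _)) _ => //.
apply: class_sat_trans (class_sat_subst (E b) (fun _ => _)) => //.
by move=> A VA e; rewrite !eval_subst /=; congr interp; apply: funext => k;
  have := ab k A VA e; rewrite !eval_subst.
Qed.

Lemma alpha_beta_congruence i : congruence (alpha i) /\ congruence (beta i).
Proof. by split; apply: subst_kernel_congruence. Qed.

Lemma subst_kernel_gen i t (k : 'I_8) :
  k = i :> nat -> subst_kernel i t (free_gen V k) (free_gen V t).
Proof.
move=> ki; rewrite /subst_kernel.
have H j : class_sat V (subst (free_term (free_gen V j)) (fun k => Var (collapse i t k)))
    (Var (collapse i t j)).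
  apply: (class_sat_subst (q := Var j) (s' := fun k => Var (collapse i t k))) => //.
  exact: class_sat_sym (free_gen_term j).
apply: class_sat_trans (H k) _; apply: class_sat_trans (class_sat_sym (H t)).
by rewrite /collapse ki eqxx; case: ifP.
Qed.

Definition idem_elt u := Defs.idempotent V (free_term u).
Definition color c u := c (psi (free_term u)).

(* [c] colours the generators; [R] may change the value of [psi] only within a
   colour class. *)
Definition respects c (R : relation F) := forall u w, idem_elt u -> R u w ->
  idem_elt w /\ color c u = color c w.

Lemma idem_elt_gen k : idem_elt (free_gen V k).
Proof.
move=> A VA e; have := @free_gen_term S V _ k; move/class_sat_sym => H.
by rewrite eval_subst (H A VA).
Qed.

Lemma psi_gen k : psi (free_term (free_gen V k)) = k.
Proof.
pose e (j : 'I_8) := j == k.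
suff : e (psi (free_term (free_gen V k))) = true by move/eqP.
have ik := idem_elt_gen k.
apply: (psiP (e' := fun _ => true) ik ik) => A VA E.
have H := class_sat_sym (@free_gen_term S V _ k).
by rewrite !eval_subst !(H A VA) /= /e eqxx.
Qed.

(** The two-valued test [e] asks whether a generator collapses to the same one as the coordinate of
    [w]. It factors through [collapse], so [u] and [w] have equal minors under it and [psi] must
    give it equal values. *)
Lemma respects_kernel c i (t : 'I_8) : c i = c t -> respects c (subst_kernel i t).
Proof.
move=> cit u w iu uw.
have iw : idem_elt w.
  move=> A VA e; rewrite -(iu A VA e); have := uw A VA (fun _ => e ord0).
  by rewrite !eval_subst.
split=> //; pose e k := collapse i t k == collapse i t (psi (free_term w)).
have : e (psi (free_term u)) = e (psi (free_term w)).
  apply: psiP => // A VA E.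
  have := uw A VA (fun k => E (k == collapse i t (psi (free_term w)))).
  by rewrite !eval_subst.
rewrite {2}/e eqxx => /eqP H; rewrite /color.
have cc (k : 'I_8) : c k = c (collapse i t k) by rewrite /collapse; case: eqP => [->|].
by rewrite cc H -cc.
Qed.

Lemma respects_alpha c i : c i = c 0 -> respects c (alpha i).
Proof. exact: respects_kernel. Qed.

Lemma respects_beta c i : c i = c 7 -> respects c (beta i).
Proof. exact: respects_kernel. Qed.

Lemma respects_clos_trans c (R : relation F) :
  respects c R -> respects c (clos_trans F R).
Proof.
move=> cR u w iu uw; elim: uw iu => {u w} [u w uw iu|u w x _ IHuw _ IHwx iu].
  exact: cR.
by have [/IHwx[? <-] <-] := IHuw iu.
Qed.

Lemma respects_join c (R R' : relation F) :
  respects c R -> respects c R' -> respects c (join R R').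
Proof.
by move=> cR cR'; apply: respects_clos_trans => u w iu [/cR|/cR']; apply.
Qed.

Lemma respects_bigjoin c (s : seq nat) (G : nat -> relation F) :
  (forall i, i \in s -> respects c (G i)) -> respects c (bigjoin s G).
Proof.
by move=> cG; apply: respects_clos_trans => u w iu [i /cG cGi]; apply: cGi.
Qed.

Lemma respects_comp c (R R' : relation F) :
  respects c R -> respects c R' -> respects c (Defs.comp R R').
Proof.
move=> cR cR' u w iu [x ux xw]; have [ix ->] := cR u x iu ux.
exact: cR' xw.
Qed.

Lemma respects_sub c (R R' : relation F) :
  inclusion F R R' -> respects c R' -> respects c R.
Proof. by move=> RR cR u w iu /RR; apply: cR. Qed.

(** The common kernel of [cs] lies in the kernel of [c]. As a Boolean test on the eight generators
    it is settled by computation for concrete colourings. *)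
Definition refines (cs : seq (nat -> nat)) c :=
  all (fun k => all (fun l => all (fun c' => c' k == c' l) cs ==> (c k == c l))
    (iota 0 8)) (iota 0 8).

Lemma respects_refines (I : seq nat) (C : nat -> nat -> nat) c (R : relation F) :
  I != [::] -> (forall i, i \in I -> respects (C i) R) ->
  refines [seq C i | i <- I] c -> respects c R.
Proof.
move=> I0 CR /allP ref u w iu uw; have iw : idem_elt w.
  by case: I I0 CR {ref} => // i I _ CR; case: (CR i (mem_head _ _) u w iu uw).
split=> //; have I8 (k : 'I_8) : (k : nat) \in iota 0 8 by rewrite mem_iota ltn_ord.
have /allP/(_ _ (I8 (psi (free_term w))))/implyP := ref _ (I8 (psi (free_term u))).
move=> H; apply/eqP/H; apply/allP => c' /mapP[i iI ->]; apply/eqP.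
by case: (CR i iI u w iu uw).
Qed.

Lemma respects_pair c1 c2 c (R : relation F) :
  respects c1 R -> respects c2 R -> refines [:: c1; c2] c -> respects c R.
Proof.
move=> r1 r2.
apply: (@respects_refines [:: 0; 1] (fun i => if i is 0 then c1 else c2)) => //.
by move=> [|i] _.
Qed.

Lemma respects_weaken c1 c (R : relation F) :
  respects c1 R -> refines [:: c1] c -> respects c R.
Proof. by move=> r1; apply: (@respects_refines [:: 0] (fun _ => c1)). Qed.

Lemma respects_meet c1 c2 c (R R' : relation F) :
  respects c1 R -> respects c2 R' -> refines [:: c1; c2] c -> respects c (meet R R').
Proof.
by move=> r1 r2; apply: respects_pair;
  [apply: respects_sub r1 | apply: respects_sub r2] => u w [].
Qed.

(** The partition whose only nontrivial block is [s]; the successor keeps the other colours away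
    from 0. *)
Definition merge (s : seq nat) (k : nat) := if k \in s then 0 else k.+1.
Definition side (s : seq nat) (k : nat) : nat := k \in s.

Lemma respects_meet_joins_at m i : 0 < i <= m ->
  respects (merge [:: 0; i; 7]) (meet_joins alpha beta m).
Proof.
move=> im; apply: (respects_sub (R' := join (alpha i) (beta i))).
  by move=> u w; apply; rewrite mem_iota; lia.
apply: respects_join; [apply: respects_alpha|apply: respects_beta];
  by rewrite /merge !inE !eqxx ?orbT.
Qed.

(** The blocks {0, i, 7} for different i share only 0 and 7. *)
Lemma respects_meet_joins5 : respects (merge [:: 0; 7]) (meet_joins alpha beta 5).
Proof.
apply: (@respects_refines (iota 1 5) (fun i => merge [:: 0; i; 7])) => // i.
by rewrite mem_iota => i5; apply: respects_meet_joins_at; lia.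
Qed.

Lemma tau_meet_joins5 : inclusion F (tau alpha beta) (meet_joins alpha beta 5).
Proof. by move=> u w uw i; rewrite mem_iota => i5; apply: uw; rewrite mem_iota; lia. Qed.

Lemma respects_tau : respects (merge [:: 0; 7]) (tau alpha beta).
Proof. exact: respects_sub tau_meet_joins5 respects_meet_joins5. Qed.

(** The block {0, 7} meets each of {0, 6} and {6, 7} in one point, so the meets inside the
    herringbone merge nothing and no block grows with [n]. *)
Lemma respects_herringbone n :
  respects (merge [:: 6; 7])
    (herringbone n (meet_joins alpha beta 5) (beta 6) (alpha 6)) /\
  respects (merge [:: 0; 6])
    (herringbone n (meet_joins alpha beta 5) (alpha 6) (beta 6)).
Proof.
elim: n => [|n [rY rZ]]; first by split; [apply: respects_beta|apply: respects_alpha].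
split; apply: respects_join.
- exact: respects_beta.
- by apply: respects_meet respects_meet_joins5 rZ _.
- exact: respects_alpha.
- by apply: respects_meet respects_meet_joins5 rY _.
Qed.

Lemma respects_herringbone_factor n : respects id (herringbone_factor alpha beta n).
Proof. exact: respects_meet respects_meet_joins5 (respects_herringbone n).1 _. Qed.

Lemma meet_joins_congruence m : congruence (meet_joins alpha beta m).
Proof.
apply: bigmeet_congruence => i _; have [? ?] := alpha_beta_congruence i.
exact: join_congruence.
Qed.

(** The commutator lies below the herringbone union, every level of which keeps all generators
    apart. *)
Lemma respects_commutator :
  respects id (commutator (tau alpha beta) (tau alpha beta)).
Proof.
have [ca6 cb6] := alpha_beta_congruence 6; have c5 := meet_joins_congruence 5.
apply: (respects_sub
  (R' := herringbone_union (meet_joins alpha beta 5) (beta 6) (alpha 6))).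
  apply: commutator_least; first exact: herringbone_union_congruence.
  apply: herringbone_centralizes => //; first exact: tau_meet_joins5.
  move=> u w /(_ 6 isT); elim=> {u w} [u w [uw|uw]|u w x _ uw _ wx].
  - by apply: t_step; right.
  - by apply: t_step; left.
  - exact: t_trans uw wx.
by move=> u w iu [n]; apply: respects_herringbone_factor.
Qed.

Lemma respects_sides c (s s' : seq nat) :
  all (fun i => c i == c 0) s -> all (fun i => c i == c 7) s' ->
  respects c (join (bigjoin s alpha) (bigjoin s' beta)).
Proof.
move=> /allP s0 /allP s7; apply: respects_join; apply: respects_bigjoin => i.
  by move/s0/eqP; apply: respects_alpha.
by move/s7/eqP; apply: respects_beta.
Qed.

Lemma respects_alphas : respects (side [:: 7]) (bigjoin (iota 1 6) alpha).
Proof.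
apply: respects_bigjoin => i i6; apply: respects_alpha.
by apply/eqP; move: i i6; apply/allP.
Qed.

Lemma respects_betas : respects (side [:: 0]) (bigjoin (iota 1 6) beta).
Proof.
apply: respects_bigjoin => i i6; apply: respects_beta.
by apply/eqP; move: i i6; apply/allP.
Qed.

Lemma equation_absurd (gamma : relation F) :
  respects id gamma -> ~ equation alpha beta gamma.
Proof.
move=> rg eq.
have rL : respects (side [:: 0; 1; 5; 6])
    (join (bigjoin (Lset 1) alpha) (bigjoin (Lset' 1) beta)).
  exact: respects_sides.
have rR1 : respects (side [:: 0; 2; 4; 6])
    (join (bigjoin (Rset 1) alpha) (bigjoin (Rset' 1) beta)).
  exact: respects_sides.
have rR2 : respects (side [:: 0; 3; 4; 5])
    (join (bigjoin (Rset 2) alpha) (bigjoin (Rset' 2) beta)).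
  exact: respects_sides.
have rgw s R : respects (side s) R -> respects (side s) (Defs.comp gamma R).
  apply: respects_comp; move=> u w iu uw; have [iw H] := rg u w iu uw.
  by split=> //; rewrite /color; congr side.
pose M := bigmeet [:: 1; 2] (fun i => join (tau alpha beta) (theta alpha beta gamma i)).
(* [d1] has blocks {0, 3, 6, 7}, {1, 5}, {2, 4}: the common refinement of the [L] and [R_1] sides,
   with 0 and 7 glued by [tau]. Likewise [d2], for [R_2], has {0, 2, 5, 7}, {1, 6}, {3, 4}. They
   jointly identify only 0 and 7. *)
pose d1 := nth 0 [:: 0; 1; 2; 0; 2; 1; 0; 0].
pose d2 := nth 0 [:: 0; 1; 0; 2; 2; 0; 1; 0].
have rM : respects (merge [:: 0; 7]) M.
  apply: (@respects_pair d1 d2) => //.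
    apply: respects_sub (fun u w (uw : M u w) => uw 1 isT) _.
    apply: respects_join; first exact: respects_weaken respects_tau _.
    exact: respects_meet rL (rgw _ _ rR1) _.
  apply: respects_sub (fun u w (uw : M u w) => uw 2 isT) _.
  apply: respects_join; first exact: respects_weaken respects_tau _.
  exact: respects_meet rL (rgw _ _ rR2) _.
(* The [alpha] join isolates 7 and the [beta] join isolates 0, so each meet with [M] separates all
   generators. *)
have rA := respects_alphas; have rB := respects_betas.
have rRHS : respects id (join (meet (bigjoin (iota 1 6) alpha) M)
    (meet (bigjoin (iota 1 6) beta) M)).
  by apply: respects_join; [exact: respects_meet rA rM _|exact: respects_meet rB rM _].
have /(rRHS _ _ (idem_elt_gen _)) : (join (meet (bigjoin (iota 1 6) alpha) M)
    (meet (bigjoin (iota 1 6) beta) M)) (free_gen V ord0) (free_gen V ord_max).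
  apply: eq => i; rewrite mem_iota => i6; have i8 : i < 8 by lia.
  exists (free_gen V (Ordinal i8)); last exact: subst_kernel_gen.
  by apply: (con_sym (subst_kernel_congruence _ _)); apply: subst_kernel_gen.
by rewrite /color !psi_gen => -[].
Qed.

End Collapse.

(** * Six-ary terms on rows of generators *)

Section Rows.
Variables (S : signature) (V : algebra S -> Prop).
Hypothesis not_taylor : ~ taylor V.
Notation F := (free_algebra V 'I_8).
Notation alpha := (@alpha S V).
Notation beta := (@beta S V).
Notation x := (@free_gen S V 'I_8 ord0).
Notation y := (@free_gen S V 'I_8 ord_max).
Notation psi u := (@psi S V not_taylor (free_term u)).

Definition mid (k : 'I_6) : F := free_gen V (widen_ord (isT : 7 <= 8) (lift ord0 k)).
Definition row (s : seq nat) (k : 'I_6) : F := if k.+1 \in s then x else y.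

Lemma mid_alpha (k : 'I_6) : alpha k.+1 (mid k) x.
Proof. exact: subst_kernel_gen. Qed.

Lemma mid_beta (k : 'I_6) : beta k.+1 (mid k) y.
Proof. exact: subst_kernel_gen. Qed.

Lemma gens_tau : tau alpha beta x y.
Proof.
move=> i; rewrite mem_iota; case: i => // i i6; pose k := Ordinal (i6 : i < 6).
apply: (t_trans _ _ _ (mid k)); apply: t_step; [left|right; exact: mid_beta k].
exact: (con_sym (alpha_beta_congruence V k.+1).1 (mid_alpha k)).
Qed.

Section SixAry.
Variable t : term S 'I_6.
Hypothesis t_idem : forall u : F, eval (fun _ => u) t = u.

Lemma row_tau s : tau alpha beta x (eval (row s) t).
Proof.
have ct : congruence (tau alpha beta) := meet_joins_congruence V 6.
rewrite -{1}(t_idem x); apply: (con_eval ct) => k; rewrite /row.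
by case: ifP => _; [apply: con_refl ct _ | apply: gens_tau].
Qed.

Lemma row_mid s s' : s != [::] -> s' != [::] ->
  (forall k : 'I_6, (k.+1 \in s') = (k.+1 \notin s)) ->
  join (bigjoin s alpha) (bigjoin s' beta) (eval mid t) (eval (row s) t).
Proof.
move=> s0 s0' ss'; apply: con_eval => [|k].
  by apply: join_congruence; apply: bigjoin_congruence => // i _;
    apply: subst_kernel_congruence.
rewrite /row; case: ifP => ks; apply: t_step; [left|right]; apply: t_step; exists k.+1.
- by [].
- exact: mid_alpha.
- by rewrite ss' ks.
- exact: mid_beta.
Qed.

(** The three rows share one value of [psi], which is 0 or 7. If it is 0, then [psi c], which is
    neither 0 nor 7, lies in the intersection of the sets [L_1], [R_1], [R_2]; if it is 7, in that
    of their complements. Both are empty. *)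
Lemma rows_absurd :
  let C := commutator (tau alpha beta) (tau alpha beta) in
  C (eval (row (Lset 1)) t) (eval (row (Rset 1)) t) ->
  C (eval (row (Rset 1)) t) (eval (row (Rset 2)) t) -> False.
Proof.
move=> C Cuv Cvw; pose c := eval mid t.
have cA (G : nat -> relation F) :
    (forall i, congruence (G i)) -> congruence (bigjoin (iota 1 6) G).
  by move=> cG; apply: bigjoin_congruence.
have ca : bigjoin (iota 1 6) alpha c x.
  rewrite -[x]t_idem; apply: con_eval => [|k].
    by apply: cA => i; apply: subst_kernel_congruence.
  by apply: t_step; exists k.+1; [rewrite mem_iota; case: (k)| apply: mid_alpha].
have cb : bigjoin (iota 1 6) beta c y.
  rewrite -[y]t_idem; apply: con_eval => [|k].
    by apply: cA => i; apply: subst_kernel_congruence.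
  by apply: t_step; exists k.+1; [rewrite mem_iota; case: (k)| apply: mid_beta].
have [iu ku] := respects_tau not_taylor (idem_elt_gen _) (row_tau (Lset 1)).
have [iv uv] := respects_commutator not_taylor iu Cuv.
have [_ vw] := respects_commutator not_taylor iv Cvw.
have ax : bigjoin (iota 1 6) alpha x c.
  by apply: con_sym ca; apply: cA => i; apply: subst_kernel_congruence.
have [ic kA] := respects_alphas not_taylor (idem_elt_gen _) ax.
have [_ kB] := respects_betas not_taylor ic cb.
have [_ kL] := @respects_sides _ _ not_taylor (side [:: 0; 1; 5; 6]) (Lset 1) (Lset' 1)
  isT isT _ _ ic (row_mid (s := Lset 1) (s' := Lset' 1) isT isT
    (fun k => ltac:(by case: k => -[|[|[|[|[|[|]]]]]]))).
have [_ k1] := @respects_sides _ _ not_taylor (side [:: 0; 2; 4; 6]) (Rset 1) (Rset' 1)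
  isT isT _ _ ic (row_mid (s := Rset 1) (s' := Rset' 1) isT isT
    (fun k => ltac:(by case: k => -[|[|[|[|[|[|]]]]]]))).
have [_ k2] := @respects_sides _ _ not_taylor (side [:: 0; 3; 4; 5]) (Rset 2) (Rset' 2)
  isT isT _ _ ic (row_mid (s := Rset 2) (s' := Rset' 2) isT isT
    (fun k => ltac:(by case: k => -[|[|[|[|[|[|]]]]]]))).
move: ku uv vw kA kB kL k1 k2; rewrite /color /= !psi_gen => ku uv vw.
rewrite -vw -uv => {uv vw}; move: ku; rewrite /merge /side.
by case: (psi c) (psi (eval (row (Lset 1)) t)) => -[|[|[|[|[|[|[|[|//]]]]]]]] ?;
  case=> -[|[|[|[|[|[|[|[|//]]]]]]]].
Qed.

End SixAry.

End Rows.

Lemma commutator_terms_taylor (S : signature) (V : algebra S -> Prop) :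
  is_variety V ->
  let x : term S 'I_2 := Var ord0 in
  let y : term S 'I_2 := Var ord_max in
  (exists t : term S 'I_6,
    [/\ class_comm_sat V (app6 t x y y y x x) (app6 t y x y x y x),
        class_comm_sat V (app6 t y x y x y x) (app6 t y y x x x y) &
        class_comm_sat V (app6 t x x x x x x) x]) -> taylor V.
Proof.
move=> hV x y [t [H1 H2 H3]]; apply: contrapT => nT.
have VF : V (free_algebra V 'I_8) by apply: free_mem.
(* For the equality congruence the commutator is equality, so [t] is idempotent outright. *)
have t_idem (u : free_algebra V 'I_8) : eval (fun _ => u) t = u.
  have := H3 _ VF eq (eq_congruence _) (fun _ => u) (fun _ _ => erefl).
  by move/(commutator_sub (eq_congruence _)); rewrite eval_app6_diag.
pose a (k : 'I_2) := @free_gen S V 'I_8 (if k == ord0 then ord0 else ord_max).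
have ct := meet_joins_congruence V 6.
have tau_a i j : tau (@alpha S V) (@beta S V) (a i) (a j).
  rewrite /a; case: ifP; case: ifP => _ _; try exact: con_refl ct _.
    exact: gens_tau.
  by apply: (con_sym ct); apply: gens_tau.
apply: (@rows_absurd S V nT t t_idem).
  have := H1 _ VF _ ct a tau_a; rewrite !eval_app6 /=.
  congr commutator; congr eval; apply: funext => -[[|[|[|[|[|[|//]]]]]] lt];
    by rewrite (tnth_nth (a ord0)).
have := H2 _ VF _ ct a tau_a; rewrite !eval_app6 /=.
congr commutator; congr eval; apply: funext => -[[|[|[|[|[|[|//]]]]]] lt];
  by rewrite (tnth_nth (a ord0)).
Qed.

Theorem theorem4p4 (S : signature) (V : algebra S -> Prop) (hV : is_variety V) :
  let x : term S 'I_2 := Var ord0 in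
  let y : term S 'I_2 := Var ord_max in
  [<-> taylor V;
       taylor (@abelian_idem_variety S V);
       exists t : term S 'I_6,
         [/\ class_comm_sat V (app6 t x y y y x x) (app6 t y x y x y x),
             class_comm_sat V (app6 t y x y x y x) (app6 t y y x x x y) &
             class_comm_sat V (app6 t x x x x x x) x];
       satisfies_commutator_equation V;
       exists n : nat, satisfies_herringbone_equation V n].
Proof.
move=> x y.
have t31 := commutator_terms_taylor hV.
have free_cong i : 1 <= i <= 6 -> congruence (@alpha S V i) /\ congruence (@beta S V i).
  by move=> _; apply: alpha_beta_congruence.
have t41 : satisfies_commutator_equation V -> taylor V.
  move=> eqV; apply: contrapT => nT; have := eqV _ (free_mem _ hV) _ _ free_cong.
  exact/equation_absurd/respects_commutator.
have t51 : (exists n, satisfies_herringbone_equation V n) -> taylor V.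
  move=> [n eqV]; apply: contrapT => nT; have := eqV _ (free_mem _ hV) _ _ free_cong.
  exact/equation_absurd/respects_herringbone_factor.
tfae.
- exact: taylor_abelian_idem.
- exact: taylor_abelian_idem_term.
(* This implication and the next pass through the Taylor condition. *)
- by move/t31; apply: taylor_commutator_equation.
(* Level 0 suffices, since its herringbone factor is already reflexive. *)
- by move/t41=> tV; exists 0; apply: taylor_herringbone_equation.
- exact: t51.
Qed.
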